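(* There exist universal constants $c,C\in(0,\infty)$ such that for all $d,n\in\mathbb N$ with $n\ge2$ and all $\gamma,\varepsilon\in(0,\infty)$, the lifted random walk on $\mathbb Z_n^d$ satisfies $$\mathrm{gap}(\mathcal L)\ \ge\ c\cdot d^{-1}\cdot\min\bigl(n^{-2}\max(1,\gamma^{-1}),\gamma\bigr)$$ and $$t_{\mathrm{rel}}(\varepsilon)\ \le\ C\cdot d^2\cdot\max\bigl(n^2\min(1,\gamma),\gamma^{-1}\bigr)\log(n/\varepsilon).$$
   Context: $\mathbb Z_n^d=\mathbb Z^d/(n\mathbb Z)^d$, and $V=\{\pm e_i:i=1,\dots,d\}$ is the set of the $2d$ signed coordinate directions ($e_i$ the unit vectors in $\mathbb Z^d$; $x+v$ is taken mod $n$). The lifted random walk on $\mathbb Z_n^d$ with rate $\gamma$ is the continuous-time Markov chain with state space $S=\mathbb Z_n^d\times V$ and generator $$\mathcal Lf(x,v)=f(x+v,v)-f(x,v)+\gamma(\Pi f-f)(x,v),\qquad \Pi f(x,v)=\frac1{2d}\sum_{w\in V}f(x,w).$$ Its unique invariant probability measure is $\mu=\mathrm{Unif}(S)$; $P_t=e^{t\mathcal L}$; $L_0^2(\mu)$ denotes the mean-zero functions in $L^2(\mu)$. $\mathrm{gap}(\mathcal L)=\inf\{\mathrm{Re}(\lambda):\lambda\text{ in the (complex) spectrum of }-\mathcal L|_{L_0^2(\mu)}\}$, and $t_{\mathrm{rel}}(\varepsilon)=\inf\{t\ge0:\|P_t\|_{L_0^2(\mu)\to L_0^2(\mu)}\l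e\varepsilon\}$.
   Formalization: The relaxation-time bound is stated only for ε ≤ n: for ε > n the logarithm log(n/ε) is negative, so the printed bound fails because t_rel(ε) ≥ 0. The gap bound is unrestricted. *)

(* Defs.v *)
From HB Require Import structures.
From mathcomp Require Import all_boot all_order all_algebra.
From mathcomp Require Import complex.
From mathcomp Require Import all_classical all_reals all_analysis.

Set Implicit Arguments.
Unset Strict Implicit.
Unset Printing Implicit Defensive.

Import Order.TTheory GRing.Theory Num.Theory.
Import numFieldNormedType.Exports.

Local Open Scope classical_set_scope.
Local Open Scope ring_scope.

(* (i, false) stands for +e_i and (i, true) for -e_i: there are always 2d
   directions, also for n = 2, where e_i and -e_i act in the same way. *)
Definition dir (d : nat) : finType := ('I_d * bool)%type.

(* 'Z_n is Z/nZ only for 1 < n. *)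
Definition state (d n : nat) : finType := ('rV['Z_n]_d * dir d)%type.

Definition dir_vec (d n : nat) (v : dir d) : 'rV['Z_n]_d :=
  (-1) ^+ v.2 *: delta_mx 0 v.1.

(* Stated over any K: used with R for the semigroup and the operator norm, and
   with R[i] (the complexified space) for the spectrum. *)
Definition velocity_average (K : numFieldType) (d n : nat)
    (f : {ffun state d n -> K}) : {ffun state d n -> K} :=
  [ffun s => (2 * d)%N%:R^-1 * \sum_(w : dir d) f (s.1, w)].

Definition generator (K : numFieldType) (d n : nat) (gamma : K)
    (f : {ffun state d n -> K}) : {ffun state d n -> K} :=
  [ffun s => f (s.1 + dir_vec n s.2, s.2) - f s
             + gamma * (velocity_average f s - f s)].

Definition mean (K : numFieldType) (S : finType) (f : {ffun S -> K}) : K :=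
  #|S|%:R^-1 * \sum_(s : S) f s.

Definition mean_zero (K : numFieldType) (S : finType) : set {ffun S -> K} :=
  [set f | mean f = 0].

Definition L2norm (R : realType) (S : finType) (f : {ffun S -> R}) : R :=
  Num.sqrt (mean [ffun s => `|f s| ^+ 2]).

Definition mean_zero_opnorm (R : realType) (S : finType)
    (T : {ffun S -> R} -> {ffun S -> R}) : \bar R :=
  ereal_sup [set (L2norm (T f))%:E | f in @mean_zero R S `&`
                                          [set f | L2norm f <= 1]].

(* P_t f = e^{tL} f, as the sum of the exponential series. *)
Definition semigroup (R : realType) (d n : nat) (gamma t : R)
    (f : {ffun state d n -> R}) : {ffun state d n -> R} :=
  [ffun s => limn (series (fun k : nat =>
     t ^+ k / k`!%:R * iter k (generator gamma) f s))].

(* Complex spectrum of the restriction of A to the mean-zero functions; on a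
   finite-dimensional space an inverse is automatically bounded. *)
Definition mean_zero_spectrum (R : realType) (S : finType)
    (A : {ffun S -> R[i]} -> {ffun S -> R[i]}) : set R[i] :=
  [set lambda | ~ set_bij (@mean_zero R[i] S) (@mean_zero R[i] S)
                    (fun f => A f - [ffun s => lambda * f s])].

Definition gap (R : realType) (d n : nat) (gamma : R) : \bar R :=
  ereal_inf [set (complex.Re lambda)%:E | lambda in
    mean_zero_spectrum
      (fun f : {ffun state d n -> R[i]} => - generator gamma%:C%C f)].

Definition t_rel (R : realType) (d n : nat) (gamma eps : R) : \bar R :=
  ereal_inf [set t%:E | t in
    [set t : R | 0 <= t /\
       (mean_zero_opnorm (@semigroup R d n gamma t) <= eps%:E)%E]].

(* Main.v *)
Require Import Defs.
From HB Require Import structures.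
From mathcomp Require Import all_boot all_order all_algebra.
From mathcomp Require Import complex ring lra.
From mathcomp Require Import all_classical all_reals all_analysis.
Set Implicit Arguments.
Unset Strict Implicit.
Unset Printing Implicit Defensive.
Import Order.TTheory GRing.Theory Num.Theory.
Import numFieldNormedType.Exports.
Local Open Scope classical_set_scope.
Local Open Scope ring_scope.

(** Write the generator as [L = T - gamma (1 - P)], with [T = S - 1] where [S]
    is the shift along the velocity and [P] is the velocity average.  Then
    [P T P = - K P], where [d K = sum_i (1 - (tau_i + tau_i^-1) / 2)] is [d]
    times minus the generator of simple random walk, and [d K] has Poincare
    constant of order [n^-2] uniformly in [d].

    For [gamma >= 1] the Dirichlet form of [L] controls [K], which gives decay
    in [L^2] at rate of order [1 / (d n^2)].  For [gamma < 1] this is too weak,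
    and one uses the modified norm [H f = |f|^2 - 2 delta <f, T W P f>] with
    [W = gamma (gamma^2 + d K)^-1].  Differentiating the cross term along the
    flow produces [<K P f, W P f>], of order at least
    [d^-1 min (n^-2 / gamma, gamma) |P f|^2] on mean-zero functions, and every
    other term is absorbed by it and by [gamma |f - P f|^2].  Having [d K]
    rather than [K] in [W] is what saves a factor [d] in the rate.

    Since [H] is equivalent to the [L^2] norm with universal constants, its
    dissipation inequality bounds both the real parts of the eigenvalues and
    the operator norm of the semigroup. *)

(** * Hypocoercivity for an abstract kinetic operator *)

Fact dissipation_arith (R : realFieldType) (delta gamma gg T Q q A t B E F : R) :
  0 <= delta -> 68 * delta <= 1 -> 0 < gamma -> 0 <= gg -> 0 <= T -> 0 <= Q ->
  0 <= q ->
  - (8 * gamma * gg + Q / 8) <= A -> - (gamma * gg + Q / 2) <= - (gamma * t) ->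
  - (8 * gamma * gg + Q / 8) <= - B -> - (8 * gamma * gg + Q / 8) <= - E ->
  - (2 * gamma * gg) <= F ->
  gamma / 2 * gg + delta * Q <= T / 2 + gamma * gg
    + delta * (2 * Q + A - gamma * t + (F - B + q - E)).
Proof.
move=> d0 d1 g0 gg0 T0 Q0 q0 a1 a2 a3 a4 a5.
(* The Young losses in |g|^2 add up to 8 + 1 + 8 + 8 + 2 = 27 multiples of [gamma * gg], and those
   in [Q] to 7/8, less than the available 2. The condition 68 [delta] <= 1 keeps 27 [delta] below
   the remaining 1/2. *)
have H : - (27 * gamma * gg) + Q <= 2 * Q + A - gamma * t + (F - B + q - E) by lra.
have := ler_wpM2l d0 H; have p0 : 0 <= gamma * gg by rewrite mulr_ge0 // ltW.
have := mulr_ge0 p0 (_ : 0 <= 1 - 68 * delta); rewrite subr_ge0 => /(_ d1).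
have := mulr_ge0 d0 p0; lra.
Qed.

Section Hypocoercivity.

Variables (R : realFieldType) (V : lmodType R) (dot : V -> V -> R).
Hypothesis dotC : forall x y, dot x y = dot y x.
Hypothesis dotDl : forall x y z, dot (x + y) z = dot x z + dot y z.
Hypothesis dotZl : forall a x y, dot (a *: x) y = a * dot x y.
Hypothesis dot_ge0 : forall x, 0 <= dot x x.

Let dotNl x y : dot (- x) y = - dot x y.
Proof. by rewrite -scaleN1r dotZl mulN1r. Qed.

Let dotDr x y z : dot z (x + y) = dot z x + dot z y.
Proof. by rewrite !(dotC z) dotDl. Qed.

Let dotZr a x y : dot x (a *: y) = a * dot x y.
Proof. by rewrite !(dotC x) dotZl. Qed.

Let dotNr x y : dot y (- x) = - dot y x.
Proof. by rewrite !(dotC y) dotNl. Qed.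

Let dotE := (dotDl, dotDr, dotZl, dotZr, dotNl, dotNr).

(** Expand |2 s x + y|^2 >= 0. The weight [s] is free, so that each error can be split between |g|^2
    and [Q] as convenient. *)
Lemma dot_young s x y : 0 < s -> - (s * dot x x + (4 * s)^-1 * dot y y) <= dot x y.
Proof.
move=> s0; have := dot_ge0 (2 * s *: x + y).
rewrite !dotE (dotC y x) => H.
rewrite -(ler_pM2l (_ : 0 < 4 * s)); last by lra.
rewrite mulrN mulrDr mulrA mulrA divff ?mul1r; last by apply/eqP; nra.
nra.
Qed.

(** The hypotheses record what holds for T = S - 1 with S orthogonal and T' = S^-1 - 1, where [D]
    stands for the dimension: [dissT] is |Sx| = |x|, [W_eq] says W = gamma (gamma^2 + D K)^-1, and
    [dotTP] combines T'T = -(T + T') with PTP = -KP. Only [normT'TP] carries a dimensional loss. *)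
Variables (T T' K W P : {linear V -> V}) (D gamma : R).
Hypothesis D_ge1 : 1 <= D.
Hypothesis gamma_gt0 : 0 < gamma.
Hypothesis adjT : forall x y, dot (T x) y = dot x (T' y).
Hypothesis normT' : forall x, dot (T' x) (T' x) = dot (T x) (T x).
Hypothesis normT : forall x, dot (T x) (T x) <= 4 * dot x x.
Hypothesis dissT : forall x, 2 * dot x (T x) = - dot (T x) (T x).
Hypothesis adjP : forall x y, dot (P x) y = dot x (P y).
Hypothesis PP : forall x, P (P x) = P x.
Hypothesis adjK : forall x y, dot (K x) y = dot x (K y).
Hypothesis KP : forall x, K (P x) = P (K x).
Hypothesis K_ge0 : forall x, 0 <= dot (K x) x.
Hypothesis WP : forall x, W (P x) = P (W x).
Hypothesis adjW : forall x y, dot (W x) y = dot x (W y).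
Hypothesis WK : forall x, W (K x) = K (W x).
Hypothesis W_eq : forall x, gamma ^+ 2 *: W x + D *: K (W x) = gamma *: x.
Hypothesis PTP : forall x, P (T (P x)) = - K (P x).
Hypothesis dotTP : forall x y, dot (T (P x)) (T (P y)) = 2 * dot (K (P x)) (P y).
Hypothesis normT'TP : forall x,
  dot (T' (T (P x))) (T' (T (P x))) <= 4 * D * dot (K (P x)) (K (P x)).

Let L x := T x - gamma *: (x - P x).
Let C x := T (W (P x)).
Let Q x := dot (K (P x)) (W (P x)).

Let D_gt0 : 0 < D. Proof. exact: lt_le_trans ltr01 D_ge1. Qed.

Let dotW x y : gamma * dot x y = gamma ^+ 2 * dot (W x) y + D * dot (K (W x)) y.
Proof. by rewrite -dotZl -W_eq !dotE. Qed.

(** Pair the resolvent identity with K W x and drop the nonnegative term gamma^2 <W x, K W x>. *)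
Let dot_KW x : dot (K (W x)) (K (W x)) * D <= gamma * dot (K x) (W x).
Proof.
have := dotW x (K (W x)); rewrite -[dot (W x) (K (W x))]adjK -adjK.
have := mulr_ge0 (sqr_ge0 gamma) (K_ge0 (W x)); lra.
Qed.

Let norm_TWP x : gamma * dot (T (W (P x))) (T (W (P x))) <= 2 * dot (K (P x)) (W (P x)).
Proof.
rewrite WP dotTP -!WP.
have := dotW (P x) (K (W (P x))); rewrite -[dot (W _) (K (W _))]adjK -adjK.
have := mulr_ge0 (ltW D_gt0) (dot_ge0 (K (W (P x)))) => h1 e.
have : gamma * (gamma * dot (K (W (P x))) (W (P x)) - dot (K (P x)) (W (P x))) <= 0.
  by rewrite mulrBr mulrA -expr2; lra.
by rewrite pmulr_rle0 //; lra.
Qed.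

Let norm_C x : dot (C x) (C x) <= dot x x.
Proof.
have hx : dot (P x) (P x) <= dot x x.
  have e : dot (P x) x = dot (P x) (P x) by rewrite -{1}PP adjP.
  have := dot_ge0 (x - P x); rewrite !dotE (dotC x (P x)) e; lra.
apply: le_trans hx; rewrite /C WP dotTP -!WP.
(* Square the resolvent identity at P x. The mixed term alone dominates gamma^2 |C x|^2, because [D]
   >= 1. *)
have e: gamma ^+ 2 * dot (P x) (P x) = gamma ^+ 4 * dot (W (P x)) (W (P x)) +
   2 * gamma ^+ 2 * D * dot (K (W (P x))) (W (P x)) + D ^+ 2 * dot (K (W (P x))) (K (W (P x))).
  by rewrite expr2 -mulrA -dotZl -dotZr -W_eq !dotE (dotC (W _) (K _)); ring.
have h1 := dot_ge0 (W (P x)); have h2 := K_ge0 (W (P x)); have h3 := dot_ge0 (K (W (P x))).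
have g2 : 0 < gamma ^+ 2 by apply: exprn_gt0.
rewrite -(ler_pM2l g2) e.
have : 0 <= gamma ^+ 4 * dot (W (P x)) (W (P x)) by rewrite mulr_ge0 // ltW // exprn_gt0.
have : 0 <= D ^+ 2 * dot (K (W (P x))) (K (W (P x))) by rewrite mulr_ge0 // sqr_ge0.
have : 0 <= (D - 1) * (gamma ^+ 2 * dot (K (W (P x))) (W (P x))).
  by rewrite !mulr_ge0 ?subr_ge0 // ltW.
lra.
Qed.

(** Makes the modified norm equivalent to the original one for small [delta], with constants
    independent of [gamma] and [D]. *)
Lemma cross_term_le x : - dot x x <= dot x (C x) <= dot x x.
Proof.
have := norm_C x; have := dot_ge0 (x + C x); have := dot_ge0 (x - C x).
rewrite !dotE (dotC _ x); lra.
Qed.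

(** The form -<x, L x> gives gamma |g|^2 for g = x - P x. The missing control of h = P x comes from
    <T h, T W h> = 2 Q in the derivative of the cross term. All other terms pair g with a vector
    whose norm is bounded by [Q] or by |g|, or have a favourable sign, and Young's inequality
    absorbs them. *)
Lemma hypocoercive_dissipation (delta : R) x : 0 <= delta -> 68 * delta <= 1 ->
  gamma / 2 * dot (x - P x) (x - P x) + delta * Q x
    <= - dot x (L x) + delta * (dot x (C (L x)) + dot (L x) (C x)).
Proof.
move=> d0 d1; have gamma0 : 0 < gamma := gamma_gt0.
have [h hE] : exists h, h = P x by exists (P x).
have [g gE] : exists g, g = x - h by exists (x - h).
have [phi phiE] : exists phi, phi = W h by exists (W h).
have [u uE] : exists u, u = P (T g) by exists (P (T g)).
have [psi psiE] : exists psi, psi = W u by exists (W u).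
have xE : x = h + g by rewrite gE addrCA subrr addr0.
have Ph : P h = h by rewrite hE PP.
have Pphi : P phi = phi by rewrite phiE -WP Ph.
have Pg : P g = 0 by rewrite gE linearB /= -hE Ph subrr.
have hg y : dot (P y) g = 0 by rewrite adjP Pg -(scale0r g) dotZr mul0r.
have PTh : P (T h) = - K h by rewrite -{1}Ph PTP Ph.
have LE : L x = T x - gamma *: g by rewrite /L -hE -gE.
have PLx : P (L x) = - K h + u.
  by rewrite LE linearB linearZ /= Pg scaler0 subr0 {1}xE !linearD /= PTh uE.
have CxE : C x = T phi by rewrite /C -hE phiE.
have QE : Q x = dot (K h) phi by rewrite /Q -hE phiE.
have CLx : C (L x) = T psi - T (K phi).
  by rewrite /C PLx linearD linearN /= WK -phiE -psiE linearD linearN /= addrC.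
have dxg : dot x g = dot g g by rewrite {1}xE dotDl hE hg add0r.
rewrite -hE -gE.
have e0 : - dot x (L x) = dot (T x) (T x) / 2 + gamma * dot g g.
  by rewrite LE !dotE dxg; have := dissT x; lra.
have e1 : dot (L x) (C x) = 2 * Q x + dot g (T' (T phi)) - gamma * dot g (T phi).
  rewrite LE CxE {1}xE linearD /= !dotE -adjT QE.
  by have := dotTP h phi; rewrite Ph Pphi => ->.
have hT y : P y = y -> dot h (T y) = - dot h (K y).
  by move=> Py; rewrite -{1}Ph adjP -{1}Py PTP Py dotNr.
have PKphi : P (K phi) = K phi by rewrite -KP Pphi.
have Ppsi : P psi = psi by rewrite psiE uE -WP PP.
have e2 : dot x (C (L x)) = dot g (T psi) - dot g (T' (K phi)) + dot (K h) (K phi)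
        - dot g (T (K phi)).
  (* Moving T, P, W and K across the inner product turns the term in K psi into one in K phi, which
     [Q] controls. *)
  have -> : dot g (T' (K phi)) = dot h (K psi).
    by rewrite -adjT -{1}PKphi -adjP -uE psiE -WK -adjW -phiE -adjK dotC.
  by rewrite CLx xE !dotE !hT // (adjK h (K phi)); lra.
(* Writing gamma h through the resolvent makes this a sum of two nonnegative forms. *)
have q0 : 0 <= dot (K h) (K phi).
  rewrite -(pmulr_rge0 _ gamma_gt0) adjK dotW -phiE -[dot phi _]adjK.
  rewrite (dotC (K phi) (K (K phi))).
  by rewrite addr_ge0 // mulr_ge0 // ?dot_ge0 ?K_ge0 ?sqr_ge0 //; exact: ltW.
have n1D : D * dot (K phi) (K phi) <= gamma * Q x.
  by have := dot_KW h; rewrite -phiE QE mulrC.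
have n1 : dot (K phi) (K phi) <= gamma * Q x.
  by apply: le_trans n1D; rewrite ler_peMl ?dot_ge0.
(* The factor [D] lost in [normT'TP] is exactly the one gained in [n1D] from having D K in the
   resolvent. *)
have n2 : dot (T' (T phi)) (T' (T phi)) <= 4 * gamma * Q x.
  by have := normT'TP phi; rewrite Pphi => H; lra.
have n3 := norm_TWP x; rewrite -hE -phiE -QE in n3.
have n4 := normT (K phi).
have n5 := normT' (K phi).
(* The bound |T psi|^2 <= 2 gamma <g, T' psi> with |T' psi| = |T psi| yields |T psi| <= 2 gamma
   |g|. *)
have n6 : dot (T psi) (T psi) <= 4 * gamma ^+ 2 * dot g g.
  have a1 : gamma * dot u psi = gamma ^+ 2 * dot psi psi + D * dot (K psi) psi.
    by rewrite dotW -psiE.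
  have a2 : dot (T psi) (T psi) = 2 * dot (K psi) psi.
    by have := dotTP psi psi; rewrite Ppsi.
  have a3 : dot u psi = dot g (T' psi) by rewrite uE adjP Ppsi adjT.
  have a4 : dot (T psi) (T psi) <= 2 * gamma * dot g (T' psi).
    have D10 : 0 <= D - 1 by rewrite subr_ge0.
    have := mulr_ge0 (sqr_ge0 gamma) (dot_ge0 psi).
    have := mulr_ge0 D10 (K_ge0 psi).
    rewrite a2 -a3; lra.
  have := dot_ge0 (2 * gamma *: g - T' psi); rewrite !dotE (dotC (T' psi)) normT'.
  nra.
have g0 := dot_ge0 g.
have T0 := dot_ge0 (T x).
have g16 : 0 < 8 * gamma by rewrite mulr_gt0.
have gne : gamma != 0 by rewrite gt_eqF.
have i32 : (4 * (8 * gamma))^-1 * (4 * gamma * Q x) = Q x / 8 by field.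
have i4 : (4 * gamma)^-1 * (4 * gamma ^+ 2 * dot g g) = gamma * dot g g by field.
have p32 : 0 <= (4 * (8 * gamma))^-1 by rewrite invr_ge0 mulr_ge0 // ltW.
have p4 : 0 <= (4 * gamma)^-1 by rewrite invr_ge0 mulr_ge0 // ltW.
(* Weight 8 gamma in Young's inequality: the dual weight 1 / (32 gamma) turns 4 gamma Q into Q /
   8. *)
have y8 z : dot z z <= 4 * gamma * Q x -> - (8 * gamma * dot g g + Q x / 8) <= dot g z.
  move=> zQ; apply: le_trans (dot_young g z g16).
  by rewrite lerN2 lerD2l -i32 ler_wpM2l.
have nTK : dot (T (K phi)) (T (K phi)) <= 4 * gamma * Q x.
  by apply: le_trans n4 _; rewrite -mulrA ler_pM2l.
have y2 : - (gamma * dot g g + Q x / 2) <= - (gamma * dot g (T phi)).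
  have := dot_young g (- T phi) (ltr01 : 0 < 1 :> R).
  rewrite !dotE opprK mulr1 mul1r => H.
  rewrite -[X in _ <= X]mulrN; apply: le_trans (ler_wpM2l (ltW gamma0) H).
  by rewrite mulrN mulrDr lerN2 lerD2l mulrCA; move: n3; lra.
rewrite e0 [dot x (C _) + _]addrC e1 e2.
apply: (dissipation_arith d0 d1 gamma0 (dot_ge0 g) (dot_ge0 (T x)) _ q0 (y8 _ n2) y2).
- rewrite -(pmulr_rge0 _ gamma_gt0); apply: le_trans n1D.
  by rewrite mulr_ge0 ?dot_ge0 // ltW.
- by rewrite -dotNr y8 // !dotE opprK n5.
- by rewrite -dotNr y8 // !dotE opprK.
- apply: le_trans (dot_young g (T psi) gamma0); rewrite lerN2.
  by have := ler_wpM2l p4 n6; rewrite i4; move: (_ * _) => z; lra.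
Qed.

(** On an eigenvector of D K with eigenvalue l, D Q equals gamma l / (gamma^2 + l) |h|^2, which
    increases with l. The proof replaces this spectral calculus by the Poincare bound at W P x and
    one Cauchy-Schwarz step. *)
Lemma cross_dissipation_ge (kappa : R) x : 0 <= kappa ->
  kappa * dot (W (P x)) (W (P x)) <= D * dot (K (W (P x))) (W (P x)) ->
  gamma * kappa * dot (P x) (P x) <= D * (gamma ^+ 2 + kappa) * Q x.
Proof.
move=> k0 Hk; rewrite /Q; set h := P x in Hk *; set phi := W h in Hk *.
have e : D * dot (K h) phi = gamma * (dot h h - gamma * dot phi h).
  by have := dotW h h; rewrite -/phi adjK (dotC _ (K h)); lra.
have f1 : (gamma ^+ 2 + kappa) * dot phi phi <= gamma * dot phi h.
  by rewrite (dotC phi h) dotW -/phi mulrDl lerD2l.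
have G0 : 0 <= gamma ^+ 2 + kappa by rewrite addr_ge0 ?sqr_ge0.
have f2 : (gamma ^+ 2 + kappa) * dot phi h <= gamma * dot h h.
  have := dot_ge0 (gamma *: h - (gamma ^+ 2 + kappa) *: phi).
  have := ler_wpM2l G0 f1; rewrite !dotE (dotC h phi) => H1 H2.
  by rewrite -(ler_pM2l gamma_gt0); lra.
rewrite [X in _ <= X]mulrAC e; have := ler_wpM2l (sqr_ge0 gamma) f2; lra.
Qed.

(** For [gamma] >= 1 no cross term is required: |T P x|^2 = 2 <K P x, P x> is at most 2 |T x|^2 + 8
    |x - P x|^2, and both norms on the right occur in the Dirichlet form. *)
Lemma coercive_dissipation (kappa : R) x : 1 <= gamma -> kappa <= 4 * D ->
  kappa * dot (P x) (P x) <= D * dot (K (P x)) (P x) ->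
  kappa / (8 * D) * dot x x <= - dot x (L x).
Proof.
move=> g1 kD Hk.
have e0 : - dot x (L x) = dot (T x) (T x) / 2 + gamma * dot (x - P x) (x - P x).
  have e : dot (P x) (P x) = dot (P x) x by rewrite [RHS]dotC adjP PP.
  have := dissT x; rewrite /L !dotE (dotC x (P x)) e; lra.
have TP : dot (T (P x)) (T (P x)) <= 2 * dot (T x) (T x) + 8 * dot (x - P x) (x - P x).
  have := dot_ge0 (T x + T (x - P x)); have := normT (x - P x).
  rewrite !linearB /= !dotE (dotC (T (P x)) (T x)) (dotC (P x) x); lra.
have e : dot x x = dot (P x) (P x) + dot (x - P x) (x - P x).
  have e : dot (P x) (P x) = dot (P x) x by rewrite [RHS]dotC adjP PP.
  by rewrite !dotE (dotC x (P x)) e; lra.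
rewrite dotTP in TP.
have gg := dot_ge0 (x - P x); have gl := ler_wpM2r gg g1.
rewrite mulrAC ler_pdivrMr ?mulr_gt0 // e0 e.
have h1 := ler_wpM2r gg kD.
have TT := mulr_ge0 (ltW D_gt0) (dot_ge0 (T x)).
have h2 := ler_wpM2l (ltW D_gt0) TP.
have h3 := ler_wpM2l (ltW D_gt0) gl.
lra.
Qed.

End Hypocoercivity.

(** * Functions on a finite set *)

Section FunctionSpace.
Variables (R : realType) (S : finType).
Implicit Types (f g : {ffun S -> R}) (p q : S -> S).

(** Left unnormalised: the factor 1 / |S| cancels in every comparison and returns only with the
    operator norm. *)
Definition dot f g : R := \sum_s f s * g s.

Lemma dotC f g : dot f g = dot g f.
Proof. by apply: eq_bigr => s _; rewrite mulrC. Qed.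

Lemma dotDl f g h : dot (f + g) h = dot f h + dot g h.
Proof. by rewrite -big_split /=; apply: eq_bigr => s _; rewrite ffunE mulrDl. Qed.

Lemma dotZl a f g : dot (a *: f) g = a * dot f g.
Proof. by rewrite mulr_sumr; apply: eq_bigr => s _; rewrite ffunE mulrA. Qed.

Lemma dot_ge0 f : 0 <= dot f f.
Proof. by apply: sumr_ge0 => s _; rewrite -expr2 sqr_ge0. Qed.

Lemma dot_eq0 f : dot f f = 0 -> f = 0.
Proof.
move=> /eqP; rewrite psumr_eq0 => [/allP f0|s _]; last by rewrite -expr2 sqr_ge0.
apply/ffunP => s; rewrite ffunE; apply/eqP.
by have := f0 s (mem_index_enum _); rewrite mulf_eq0 orbb.
Qed.

Lemma dotNl f g : dot (- f) g = - dot f g.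
Proof. by rewrite -scaleN1r dotZl mulN1r. Qed.

Lemma dotDr f g h : dot h (f + g) = dot h f + dot h g.
Proof. by rewrite !(dotC h) dotDl. Qed.

Lemma dotZr a f g : dot f (a *: g) = a * dot f g.
Proof. by rewrite !(dotC f) dotZl. Qed.

Lemma dotNr f g : dot g (- f) = - dot g f.
Proof. by rewrite !(dotC g) dotNl. Qed.

Lemma dot0l f : dot 0 f = 0.
Proof. by rewrite -(scale0r 0) dotZl mul0r. Qed.

Definition dotE := (dotDl, dotDr, dotZl, dotZr, dotNl, dotNr).

Lemma dot_suml I r (F : I -> {ffun S -> R}) g :
  dot (\sum_(i <- r) F i) g = \sum_(i <- r) dot (F i) g.
Proof.
by elim/big_rec2: _ => [|i y z _ <-]; rewrite ?dot0l // dotDl.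
Qed.

Lemma dot_sumr I r (F : I -> {ffun S -> R}) g :
  dot g (\sum_(i <- r) F i) = \sum_(i <- r) dot g (F i).
Proof. by rewrite dotC dot_suml; apply: eq_bigr => i _; rewrite dotC. Qed.

(** Cauchy-Schwarz. In the induction step the mixed terms are bounded by 2 <F_i, F_j> <= |F_i|^2 +
    |F_j|^2. *)
Lemma dot_sum_le I (r : seq I) (F : I -> {ffun S -> R}) :
  dot (\sum_(i <- r) F i) (\sum_(i <- r) F i)
    <= (size r)%:R * \sum_(i <- r) dot (F i) (F i).
Proof.
elim: r => [|i r IH]; first by rewrite !big_nil dot0l mul0r.
rewrite !big_cons /=; set G := \sum_(j <- r) F j in IH *.
have : 2 * dot (F i) G <= (size r)%:R * dot (F i) (F i) + \sum_(j <- r) dot (F j) (F j).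
  rewrite /G dot_sumr mulr_sumr.
  have -> : (size r)%:R * dot (F i) (F i) = \sum_(j <- r) dot (F i) (F i).
    by rewrite big_const_seq count_predT iter_addr_0 mulr_natl.
  rewrite -big_split /=; apply: ler_sum => j _.
  by have := dot_ge0 (F i - F j); rewrite !dotE (dotC (F j)); lra.
by rewrite !dotE (dotC G) -natr1 => H; lra.
Qed.

Definition pull p f : {ffun S -> R} := [ffun s => f (p s)].

Lemma pull_is_linear p : linear (pull p).
Proof. by move=> a f g; apply/ffunP => s; rewrite !ffunE. Qed.
HB.instance Definition _ p :=
  GRing.isLinear.Build R {ffun S -> R} {ffun S -> R} _ (pull p) (pull_is_linear p).

Lemma dot_pull p f g : bijective p -> dot (pull p f) (pull p g) = dot f g.
Proof.
move=> pb; rewrite [RHS](reindex p) /=; last exact: onW_bij.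
by apply: eq_bigr => s _; rewrite !ffunE.
Qed.

Lemma pullK p q : cancel p q -> forall f, pull p (pull q f) = f.
Proof. by move=> pK f; apply/ffunP => s; rewrite !ffunE pK. Qed.

Lemma dot_pull_adj p q f g : cancel p q -> cancel q p ->
  dot (pull p f) g = dot f (pull q g).
Proof. by move=> pK qK; rewrite -{1}(pullK pK g) dot_pull //; exists q. Qed.

End FunctionSpace.
Arguments pull {R S}.

(** Finite dimension. This serves both to construct the resolvent and to turn spectral values into
    eigenvalues. *)
Lemma injective_linear_inverse (F : fieldType) (V : vectType F)
    (f : {linear V -> V}) : (forall x, f x = 0 -> x = 0) ->
  exists g : {linear V -> V}, forall x, f (g x) = x.
Proof.
move=> f0; have k0 : lker (linfun f) == 0%VS.
  apply/lker0P => x y; rewrite !lfunE /= => /eqP.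
  by rewrite -subr_eq0 -linearB => /eqP/f0/subr0_eq.
by exists (linfun f)^-1%VF => x; rewrite -[LHS](lfunE f) lker0_lfunVK.
Qed.

(** * The operators of the walk *)

Section Walk.
Variables (R : realType) (d n : nat).
Hypothesis d_gt0 : (0 < d)%N.
Local Notation S := (state d n).
Local Notation fct := {ffun S -> R}.
Implicit Types (f g : fct) (a b : 'rV['Z_n]_d).

Definition flow (s : S) : S := (s.1 + dir_vec n s.2, s.2).
Definition flow_inv (s : S) : S := (s.1 - dir_vec n s.2, s.2).
Definition tran a (s : S) : S := (s.1 + a, s.2).

Lemma flowK : cancel flow flow_inv.
Proof. by case=> x v; rewrite /flow_inv /flow /= addrK. Qed.
Lemma flow_invK : cancel flow_inv flow.
Proof. by case=> x v; rewrite /flow_inv /flow /= subrK. Qed.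
Lemma tranK a : cancel (tran a) (tran (- a)).
Proof. by case=> x v; rewrite /tran /= addrK. Qed.
Lemma tranNK a : cancel (tran (- a)) (tran a).
Proof. by case=> x v; rewrite /tran /= subrK. Qed.
Lemma tran_bij a : bijective (tran a).
Proof. by exists (tran (- a)); [exact: tranK | exact: tranNK]. Qed.
Lemma flow_bij : bijective flow.
Proof. by exists flow_inv; [exact: flowK | exact: flow_invK]. Qed.
Lemma flow_inv_bij : bijective flow_inv.
Proof. by exists flow; [exact: flow_invK | exact: flowK]. Qed.

Lemma pull_tranD a b f : pull (tran a) (pull (tran b) f) = pull (tran (a + b)) f.
Proof. by apply/ffunP => s; rewrite !ffunE /tran /= addrA. Qed.

Lemma pull_tranC a b f :
  pull (tran a) (pull (tran b) f) = pull (tran b) (pull (tran a) f).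
Proof. by rewrite !pull_tranD addrC. Qed.

Definition e_ i : 'rV['Z_n]_d := delta_mx 0 i.

Lemma sum_dir (M : zmodType) (F : dir d -> M) :
  \sum_(w : dir d) F w = \sum_i (F (i, false) + F (i, true)).
Proof.
rewrite (eq_bigr (fun p => F (p.1, p.2))) => [|[]//].
rewrite -(pair_bigA _ (fun i c => F (i, c))) /=; apply: eq_bigr => i _.
by rewrite big_bool addrC.
Qed.

Lemma dir_vec_false i : dir_vec n (i, false) = e_ i.
Proof. by rewrite /dir_vec expr0 scale1r. Qed.
Lemma dir_vec_true i : dir_vec n (i, true) = - e_ i.
Proof. by rewrite /dir_vec expr1 scaleN1r. Qed.

(** [adv], [adv_adj] and [mlap] are the T, T' and K of the abstract argument, with D = d. The
    operators [lap i] are the one-coordinate Laplacians that make up d K. *)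
Definition adv f : fct := pull flow f - f.
Definition adv_adj f : fct := pull flow_inv f - f.
Definition lap i f : fct := f - 2^-1 *: (pull (tran (e_ i)) f + pull (tran (- e_ i)) f).
Definition mlap f : fct := d%:R^-1 *: \sum_i lap i f.

Fact adv_is_linear : linear adv.
Proof.
by move=> a f g; apply/ffunP => s; rewrite !ffunE /GRing.scale /=; ring.
Qed.
HB.instance Definition _ := GRing.isLinear.Build R fct fct _ adv adv_is_linear.

Fact adv_adj_is_linear : linear adv_adj.
Proof.
by move=> a f g; apply/ffunP => s; rewrite !ffunE /GRing.scale /=; ring.
Qed.
HB.instance Definition _ := GRing.isLinear.Build R fct fct _ adv_adj adv_adj_is_linear.

Fact lap_is_linear i : linear (lap i).
Proof. move=> a f g; apply/ffunP => s; rewrite !ffunE /GRing.scale /=; ring. Qed.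
HB.instance Definition _ i := GRing.isLinear.Build R fct fct _ (lap i) (lap_is_linear i).

Fact mlap_is_linear : linear mlap.
Proof.
move=> a f g; rewrite /mlap scalerA mulrC -scalerA -scalerDr; congr (_ *: _).
by rewrite scaler_sumr -big_split /=; apply: eq_bigr => i _; rewrite linearP.
Qed.
HB.instance Definition _ := GRing.isLinear.Build R fct fct _ mlap mlap_is_linear.

Local Notation P := (@velocity_average R d n).

Fact velocity_average_is_linear : linear P.
Proof.
move=> a f g; apply/ffunP => s; rewrite !ffunE /GRing.scale /= mulrCA -mulrDr; congr (_ * _).
by rewrite mulr_sumr -big_split /=; apply: eq_bigr => w _; rewrite !ffunE.
Qed.
HB.instance Definition _ := GRing.isLinear.Build R fct fct _ P velocity_average_is_linear.

Lemma generatorE gamma f : generator gamma f = adv f - gamma *: (f - P f).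
Proof. by apply/ffunP => s; rewrite !ffunE /GRing.scale /= -mulrN opprB. Qed.

Lemma card_dirE : #|{: dir d}| = (2 * d)%N.
Proof. by rewrite card_prod card_ord card_bool mulnC. Qed.

Lemma velocity_average_fiber f x v v' : P f (x, v) = P f (x, v').
Proof. by rewrite !ffunE. Qed.

Lemma velocity_average_fixed f : (forall x v v', f (x, v) = f (x, v')) -> P f = f.
Proof.
move=> fv; apply/ffunP => -[x v]; rewrite ffunE /=.
under eq_bigr do rewrite (fv x _ v).
rewrite sumr_const card_dirE -[f _ *+ _]mulr_natl mulrA mulVf ?mul1r //.
by rewrite pnatr_eq0 muln_eq0 -lt0n d_gt0.
Qed.

Lemma velocity_average_idem f : P (P f) = P f.
Proof. by apply: velocity_average_fixed => x v v'; rewrite !ffunE. Qed.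

Lemma dot_pair f g : dot f g = \sum_x \sum_v f (x, v) * g (x, v).
Proof. by rewrite pair_bigA; apply: eq_bigr => -[]. Qed.

Lemma dot_velocity_average f g : dot (P f) g = dot f (P g).
Proof.
rewrite !dot_pair; apply: eq_bigr => x _.
under eq_bigr do rewrite ffunE -mulrA mulr_suml.
rewrite -mulr_sumr exchange_big mulr_sumr; apply: eq_bigr => v _.
by rewrite /= -mulr_sumr ffunE /= mulrCA.
Qed.

Lemma velocity_average_tran a f : P (pull (tran a) f) = pull (tran a) (P f).
Proof. by apply/ffunP => s; rewrite !ffunE; under eq_bigr do rewrite ffunE. Qed.

Lemma lap_tran a i f : lap i (pull (tran a) f) = pull (tran a) (lap i f).
Proof. by apply/ffunP => s; rewrite !ffunE /tran /= ![s.1 + _ + a]addrAC. Qed.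

Lemma velocity_average_lap i f : P (lap i f) = lap i (P f).
Proof. by rewrite /lap (linearB P) (linearZ_LR P) (linearD P) /= !velocity_average_tran. Qed.

Lemma mlap_velocity_average f : mlap (P f) = P (mlap f).
Proof.
rewrite /mlap (linearZ_LR P) (linear_sum P) /=; congr (_ *: _).
by apply: eq_bigr => i _; rewrite velocity_average_lap.
Qed.

Lemma dot_lap i f g : dot (lap i f) g = dot f (lap i g).
Proof.
rewrite /lap !dotE (dot_pull_adj _ _ (tranK (e_ i)) (tranNK _)).
rewrite (dot_pull_adj _ _ (tranNK (e_ i)) (tranK _)); lra.
Qed.

Lemma dot_lap_self i f :
  2 * dot (lap i f) f = dot (f - pull (tran (e_ i)) f) (f - pull (tran (e_ i)) f).
Proof.
rewrite /lap !dotE (dot_pull_adj _ _ (tranNK (e_ i)) (tranK _)) (dot_pull _ _ (tran_bij _)).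
rewrite (dotC (pull _ f) f); lra.
Qed.

Lemma dot_lap_ge0 i f : 0 <= dot (lap i f) f.
Proof. by have := dot_lap_self i f; have := dot_ge0 (f - pull (tran (e_ i)) f); lra. Qed.

(** Twice this product is <lap_j g, g> for g = f - tau_i f, because the Laplacians commute with
    translations and 2 lap_i = (1 - tau_i)^* (1 - tau_i). *)
Lemma dot_lap_lap i j f : 0 <= dot (lap i f) (lap j f).
Proof.
have := dot_lap_ge0 j (f - pull (tran (e_ i)) f).
rewrite (linearB (lap j)) /= lap_tran; move: (lap j f) => u.
rewrite /lap !dotE (dot_pull _ _ (tran_bij _)).
rewrite (dot_pull_adj _ _ (tranNK (e_ i)) (tranK _)).
rewrite (dotC f u) (dotC f (pull _ u)) (dotC (pull _ f) u); lra.
Qed.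

Lemma dot_mlap f g : dot (mlap f) g = dot f (mlap g).
Proof.
rewrite /mlap !dotE dot_suml dot_sumr; congr (_ * _).
by apply: eq_bigr => i _; rewrite dot_lap.
Qed.

Lemma dot_mlap_ge0 f : 0 <= dot (mlap f) f.
Proof.
rewrite /mlap dotE dot_suml mulr_ge0 ?invr_ge0 ?ler0n // sumr_ge0 // => i _.
exact: dot_lap_ge0.
Qed.

Let d_neq0 : d%:R != 0 :> R. Proof. by rewrite pnatr_eq0 -lt0n. Qed.

Lemma sum_lap f : \sum_i lap i f = d%:R *: mlap f.
Proof. by rewrite /mlap scalerA divff // scale1r. Qed.

Lemma sum_norm_lap f :
  \sum_i dot (lap i f) (lap i f) <= d%:R ^+ 2 * dot (mlap f) (mlap f).
Proof.
rewrite expr2 -mulrA -dotZl -dotZr -sum_lap dot_suml ler_sum // => i _.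
rewrite dot_sumr (bigD1 i) //= lerDl sumr_ge0 // => j _; exact: dot_lap_lap.
Qed.

Lemma velocity_average_fiberE f x v v' : P f = f -> f (x, v) = f (x, v').
Proof. by move=> <-; apply: velocity_average_fiber. Qed.

Lemma neighbour_sum f x v i : P f = f ->
  f (x + e_ i, (i, false)) + f (x - e_ i, (i, true)) = 2 * (f (x, v) - lap i f (x, v)).
Proof.
move=> Pf; rewrite /lap !ffunE /GRing.scale /= /tran /=.
rewrite (velocity_average_fiberE _ _ v Pf) [f (_ - _, _)](velocity_average_fiberE _ _ v Pf).
by field.
Qed.

Lemma sum_neighbours f s : P f = f ->
  (2 * d)%:R^-1 * (\sum_i (f (s.1 + e_ i, (i, false)) + f (s.1 - e_ i, (i, true))))
    = (f - mlap f) s.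
Proof.
case: s => x v Pf; under eq_bigr do rewrite (neighbour_sum x v _ Pf).
rewrite /mlap !ffunE /GRing.scale /= sum_ffunE -mulr_sumr sumrB sumr_const card_ord.
rewrite -[_ *+ d]mulr_natl natrM; by field.
Qed.

Lemma velocity_average_flow f : P f = f -> P (pull flow f) = f - mlap f.
Proof.
move=> Pf; apply/ffunP => s; rewrite -sum_neighbours // ffunE sum_dir; congr (_ * _).
by apply: eq_bigr => i _; rewrite !ffunE /flow /= dir_vec_false dir_vec_true.
Qed.

Lemma velocity_average_flow_inv f : P f = f -> P (pull flow_inv f) = f - mlap f.
Proof.
move=> Pf; apply/ffunP => s; rewrite -sum_neighbours // ffunE sum_dir; congr (_ * _).
apply: eq_bigr => i _; rewrite !ffunE /flow_inv /= dir_vec_false dir_vec_true opprK addrC.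
by congr (_ + _); apply: velocity_average_fiberE.
Qed.

Lemma velocity_average_adv f : P (adv (P f)) = - mlap (P f).
Proof.
rewrite (linearB P) /= velocity_average_flow ?velocity_average_idem //.
by rewrite addrAC subrr add0r.
Qed.

Lemma velocity_average_adv_adj f : P (adv_adj (P f)) = - mlap (P f).
Proof.
rewrite (linearB P) /= velocity_average_flow_inv ?velocity_average_idem //.
by rewrite addrAC subrr add0r.
Qed.

Lemma dot_adv f g : dot (adv f) g = dot f (adv_adj g).
Proof. by rewrite !dotE (dot_pull_adj _ _ flowK flow_invK). Qed.

Lemma norm_adv_adj f : dot (adv_adj f) (adv_adj f) = dot (adv f) (adv f).
Proof.
rewrite !dotE (dot_pull _ _ flow_bij) (dot_pull _ _ flow_inv_bij).
rewrite (dot_pull_adj _ _ flowK flow_invK) (dot_pull_adj _ _ flow_invK flowK); lra.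
Qed.

Lemma norm_adv f : dot (adv f) (adv f) <= 4 * dot f f.
Proof.
have := dot_ge0 (pull flow f + f); rewrite !dotE (dot_pull _ _ flow_bij); lra.
Qed.

Lemma dot_adv_self f : 2 * dot f (adv f) = - dot (adv f) (adv f).
Proof. rewrite !dotE (dot_pull _ _ flow_bij) (dotC (pull _ _)); lra. Qed.

(** This is (S^-1 - 1)(S - 1) = 2 - S - S^-1, a second difference along the velocity. *)
Lemma adv_adj_adv f : adv_adj (adv f) = - (adv f + adv_adj f).
Proof.
apply/ffunP => s; rewrite !ffunE flow_invK; ring.
Qed.

Lemma dot_adv_velocity_average f g :
  dot (adv (P f)) (adv (P g)) = 2 * dot (mlap (P f)) (P g).
Proof.
rewrite dotC dot_adv adv_adj_adv -velocity_average_idem dot_velocity_average.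
rewrite (linearN P) (linearD P) /= velocity_average_adv velocity_average_adv_adj.
rewrite velocity_average_idem dotC !dotE; lra.
Qed.

Lemma adv_adj_adv_fiber f x i c : P f = f ->
  adv_adj (adv f) (x, (i, c)) = 2 * lap i f (x, (i, c)).
Proof.
move=> Pf; rewrite adv_adj_adv /lap !ffunE /GRing.scale /= /flow /flow_inv /tran /=.
case: c; rewrite ?dir_vec_true ?dir_vec_false ?opprK; by field.
Qed.

(** At velocity +e_i or -e_i the function T'T h equals 2 lap_i h. These are 2 of the 2d velocities,
    so the square norm is (4 / d) sum_i |lap_i h|^2, to which [sum_norm_lap] applies. *)
Lemma norm_adv_adj_adv f :
  dot (adv_adj (adv (P f))) (adv_adj (adv (P f)))
    <= 4 * d%:R * dot (mlap (P f)) (mlap (P f)).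
Proof.
set h := P f; have Ph : P h = h by rewrite velocity_average_idem.
have lapE i x v v' : lap i h (x, v) = lap i h (x, v').
  by apply: velocity_average_fiberE; rewrite velocity_average_lap Ph.
have sumE i : dot (lap i h) (lap i h) =
    d%:R * \sum_x (lap i h (x, (i, false)) ^+ 2 + lap i h (x, (i, true)) ^+ 2).
  rewrite dot_pair mulr_sumr; apply: eq_bigr => x _.
  under eq_bigr => v _ do rewrite (lapE i x v (i, false)).
  rewrite (lapE i x (i, true) (i, false)) sumr_const card_dirE -[_ *+ _]mulr_natl natrM.
  by ring.
have -> : dot (adv_adj (adv h)) (adv_adj (adv h)) =
   4 * (d%:R^-1 * \sum_i dot (lap i h) (lap i h)).
  under [in RHS]eq_bigr do rewrite sumE.
  rewrite -mulr_sumr [X in 4 * X]mulrA mulVf // mul1r exchange_big dot_pair mulr_sumr.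
  apply: eq_bigr => x _; rewrite sum_dir mulr_sumr; apply: eq_bigr => i _.
  rewrite !adv_adj_adv_fiber //; ring.
rewrite -mulrA ler_pM2l // ler_pdivrMl ?ltr0n // mulrA -expr2; exact: sum_norm_lap.
Qed.

End Walk.

(** * The Poincare inequality on the torus *)

Section Poincare.
Variables (R : realType) (d n : nat).
Hypotheses (d_gt0 : (0 < d)%N) (n_gt1 : (1 < n)%N).
Local Notation S := (state d n).
Local Notation fct := {ffun S -> R}.
Implicit Types (f g : fct).
Local Notation e_ i := (@e_ d n i).
Local Notation P := (@velocity_average R d n).
Local Notation tau a := (@pull R S (tran a)).

(** Telescope into m translates of f - tau_i f, all of equal norm, and apply Cauchy-Schwarz. *)
Lemma norm_tran_muln i m f :
  dot (f - tau (e_ i *+ m) f) (f - tau (e_ i *+ m) f)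
    <= m%:R ^+ 2 * dot (f - tau (e_ i) f) (f - tau (e_ i) f).
Proof.
have -> : f - tau (e_ i *+ m) f =
    \sum_(0 <= k < m) tau (e_ i *+ k) (f - tau (e_ i) f).
  elim: m => [|m IH].
    rewrite big_geq // mulr0n; apply/ffunP => s.
    by rewrite !ffunE /tran addr0 -surjective_pairing subrr.
  rewrite big_nat_recr //= -IH (linearB (tau _)) /= pull_tranD -mulrSr.
  by rewrite addrA subrK.
apply: le_trans (dot_sum_le _ _) _; rewrite size_iota subn0 expr2 -mulrA ler_wpM2l //.
under eq_bigr do rewrite (dot_pull _ _ (tran_bij _)).
by rewrite sumr_const_nat subn0 mulr_natl.
Qed.

(** Orthogonal projection onto the functions that do not depend on the i-th coordinate. *)
Definition line_average i f : fct :=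
  n%:R^-1 *: \sum_(k : 'Z_n) tau (k *: e_ i) f.

Fact line_average_is_linear i : linear (line_average i).
Proof.
move=> a f g; rewrite /line_average scalerA mulrC -scalerA -scalerDr; congr (_ *: _).
by rewrite scaler_sumr -big_split /=; apply: eq_bigr => k _; rewrite linearP.
Qed.
HB.instance Definition _ i :=
  GRing.isLinear.Build R fct fct _ (line_average i) (line_average_is_linear i).

Let n_neq0 : n%:R != 0 :> R. Proof. by rewrite pnatr_eq0 -lt0n ltnW. Qed.

Lemma card_Zn : #|{: 'Z_n}| = n.
Proof. by rewrite card_ord Zp_cast. Qed.

Lemma size_index_Zn : size (index_enum 'Z_n) = n.
Proof. by rewrite [index_enum _]unlock -enumT -cardT card_Zn. Qed.

Lemma line_average_tran a i f : line_average i (tau a f) = tau a (line_average i f).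
Proof.
rewrite /line_average (linearZ_LR (tau a)) (linear_sum (tau a)) /=; congr (_ *: _).
by apply: eq_bigr => k _; rewrite pull_tranC.
Qed.

Lemma line_average_invariant i k f :
  tau (k *: e_ i) (line_average i f) = line_average i f.
Proof.
rewrite -line_average_tran /line_average; congr (_ *: _).
rewrite [RHS](reindex_inj (addIr k)) /=; apply: eq_bigr => j _.
by rewrite pull_tranD scalerDl.
Qed.

Lemma line_averageE i f :
  f - line_average i f = n%:R^-1 *: \sum_(k : 'Z_n) (f - tau (k *: e_ i) f).
Proof.
rewrite /line_average sumrB sumr_const card_Zn scalerBr.
by rewrite -[f *+ _]scaler_nat scalerA mulVf ?scale1r.
Qed.

Lemma norm_line_average i f :
  dot f f = dot (line_average i f) (line_average i f)
    + dot (f - line_average i f) (f - line_average i f).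
Proof.
have orth : dot (line_average i f) (f - line_average i f) = 0.
  rewrite line_averageE dotZr dot_sumr big1 ?mulr0 // => k _.
  by rewrite dotDr dotNr -{2}(line_average_invariant i k) (dot_pull _ _ (tran_bij _)) subrr.
by move: (line_average i f) orth => g; rewrite !dotE (dotC f); lra.
Qed.

(** One-dimensional Poincare inequality: the left side is an average of f - tau_i^k f with k < n,
    each controlled by telescoping. *)
Lemma norm_sub_line_average i f :
  dot (f - line_average i f) (f - line_average i f)
    <= n%:R ^+ 2 * dot (f - tau (e_ i) f) (f - tau (e_ i) f).
Proof.
rewrite line_averageE dotZl dotZr mulrA -invfM -expr2.
rewrite ler_pdivrMl ?exprn_gt0 ?ltr0n ?(ltnW n_gt1) //.
apply: le_trans (dot_sum_le _ _) _; rewrite size_index_Zn expr2 -mulrA ler_wpM2l //.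
apply: le_trans (_ : \sum_(k : 'Z_n) n%:R ^+ 2 * dot (f - tau (e_ i) f) (f - tau (e_ i) f) <= _).
  apply: ler_sum => k _; have -> : k *: e_ i = e_ i *+ k by rewrite -{1}(natr_Zp k) scaler_nat.
  apply: le_trans (norm_tran_muln _ _ _) _; rewrite ler_wpM2r ?dot_ge0 //.
  by rewrite lerXn2r ?nnegrE // ler_nat ltnW // -{2}(Zp_cast n_gt1).
by rewrite sumr_const card_Zn -[_ *+ n]mulr_natl.
Qed.

Lemma line_average_contraction i f :
  dot (line_average i f) (line_average i f) <= dot f f.
Proof. by rewrite [leRHS](norm_line_average i) lerDl dot_ge0. Qed.

Definition lines_average s f := foldr line_average f s.

Lemma lines_average_tran a s f : lines_average s (tau a f) = tau a (lines_average s f).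
Proof. by elim: s => //= i s ->; rewrite line_average_tran. Qed.

Lemma lines_averageB s f g :
  lines_average s (f - g) = lines_average s f - lines_average s g.
Proof. by elim: s => //= i s ->; rewrite (linearB (line_average i)). Qed.

Lemma lines_average_contraction s f :
  dot (lines_average s f) (lines_average s f) <= dot f f.
Proof.
elim: s => //= i s; exact: le_trans (line_average_contraction _ _).
Qed.

(** One more average loses at most n^2 |(1 - tau_i) g|^2 by Pythagoras, with g already averaged over
    [s]. Since the averages commute with translations and contract, g may be replaced by f there. *)
Lemma norm_lines_average s f :
  dot f f <= dot (lines_average s f) (lines_average s f)
    + n%:R ^+ 2 * \sum_(i <- s) dot (f - tau (e_ i) f) (f - tau (e_ i) f).
Proof.
elim: s => [|i s IH] /=; first by rewrite big_nil mulr0 addr0.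
apply: le_trans IH _; rewrite (norm_line_average i) big_cons mulrDr addrA lerD2r lerD2l.
apply: le_trans (norm_sub_line_average _ _) _; rewrite ler_wpM2l ?sqr_ge0 //.
by rewrite -lines_average_tran -lines_averageB lines_average_contraction.
Qed.

Lemma lines_average_invariant i k s f : i \in s ->
  tau (k *: e_ i) (lines_average s f) = lines_average s f.
Proof.
elim: s => //= j s IH; rewrite inE => /orP[/eqP ->|/IH {}IH].
  exact: line_average_invariant.
by rewrite -line_average_tran IH.
Qed.

Lemma lines_average_fiber s f : P f = f -> P (lines_average s f) = lines_average s f.
Proof.
move=> Pf; elim: s => //= i s IH.
rewrite /line_average (linearZ_LR P) (linear_sum P) /=; congr (_ *: _).
by apply: eq_bigr => k _; rewrite velocity_average_tran IH.
Qed.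

Lemma sum_tran a f : \sum_s tau a f s = \sum_s f s.
Proof.
rewrite [RHS](reindex (tran a)) /=; last exact: onW_bij (tran_bij _).
by apply: eq_bigr => s _; rewrite ffunE.
Qed.

Lemma sum_lines_average s f : \sum_x lines_average s f x = \sum_x f x.
Proof.
elim: s => //= i s <-; under eq_bigr do rewrite ffunE sum_ffunE.
rewrite -mulr_sumr exchange_big /=; under eq_bigr do rewrite sum_tran.
by rewrite sumr_const card_Zn -[X in _ * X]mulr_natl mulrA mulVf ?mul1r.
Qed.

(** After averaging over all coordinates the function is invariant under every translation; being
    independent of the velocity as well, it is constant, and its sum is still 0. *)
Lemma lines_average_eq0 f : P f = f -> \sum_x f x = 0 ->
  lines_average (enum 'I_d) f = 0.
Proof.
move=> Pf f0; set p := lines_average _ f.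
have Pp : P p = p by apply: lines_average_fiber.
have inv a : tau a p = p.
  rewrite [a]row_sum_delta; elim/big_ind: _ => [|b c pb pc|i _].
  - by apply/ffunP => s; rewrite ffunE /tran addr0 -surjective_pairing.
  - by rewrite -pull_tranD pc pb.
  - by apply: lines_average_invariant; rewrite mem_enum.
have const s s' : p s = p s'.
  case: s s' => [x v] [y w]; rewrite -{1}(inv (y - x)) ffunE /tran /= addrC subrK.
  exact: velocity_average_fiberE.
apply/ffunP => s; rewrite ffunE; have := sum_lines_average (enum 'I_d) f.
rewrite f0 -/p; under eq_bigr do rewrite (const _ s).
move/eqP; rewrite sumr_const -[_ *+ _]mulr_natl mulf_eq0 pnatr_eq0 => /orP[|/eqP //].
by rewrite -leqn0 leqNgt => /negP; case; apply/card_gt0P; exists s.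
Qed.

(* Efron-Stein: averaging over the coordinates one after another loses no
   factor of d. *)
Lemma poincare f : P f = f -> \sum_x f x = 0 ->
  (2 * n%:R ^+ 2)^-1 * dot f f <= d%:R * dot (mlap f) f.
Proof.
move=> Pf f0; have n20 : 0 < 2 * n%:R ^+ 2 :> R by rewrite mulr_gt0 ?exprn_gt0 ?ltr0n ?(ltnW n_gt1).
rewrite ler_pdivrMl // -dotZl -sum_lap // dot_suml.
have := norm_lines_average (enum 'I_d) f; rewrite lines_average_eq0 // dot0l add0r.
rewrite big_enum /=; under eq_bigr do rewrite -dot_lap_self.
by rewrite -mulr_sumr mulrA (mulrC _ 2).
Qed.

End Poincare.

(** * The modified norm *)

(** The modified norm in polarised form: twice its value at (f, L f) is the derivative of the
    quadratic form along the flow. *)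
Definition lyapunov (R : realType) (S : finType) (C : {ffun S -> R} -> {ffun S -> R})
    (delta : R) (f g : {ffun S -> R}) : R :=
  dot f g - delta * (dot f (C g) + dot g (C f)).

(** The two bounds on [m] give m (gamma^2 + kappa) <= 3 gamma kappa, hence m |h|^2 <= 3 D Q. The
    constant 500 suffices because 2 * 3 * 68 = 408. *)
Fact rate_arith (R : realFieldType) (gamma kappa D m hh gg Q : R) :
  0 < gamma -> 0 < kappa -> 1 <= D -> 0 <= m -> m * gamma <= 2 * kappa -> m <= gamma ->
  0 <= hh -> 0 <= gg -> gamma * kappa * hh <= D * (gamma ^+ 2 + kappa) * Q ->
  500^-1 * D^-1 * m * (2 * (hh + gg)) <= gamma / 2 * gg + 68^-1 * Q.
Proof.
move=> g0 k0 D1 m0 m1 m2 h0 gg0 HQ; have D0 : 0 < D by apply: lt_le_trans D1.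
have G0 : 0 < gamma ^+ 2 + kappa by rewrite addr_gt0 ?exprn_gt0.
have a1 : m * (gamma ^+ 2 + kappa) <= 3 * (gamma * kappa).
  have := ler_wpM2l (ltW g0) m1; have := ler_wpM2r (ltW k0) m2; lra.
have a2 : m * hh <= 3 * (D * Q).
  by rewrite -(ler_pM2l G0); have := ler_wpM2r h0 a1; lra.
have a3 : D^-1 * (m * hh) <= 3 * Q by rewrite ler_pdivrMl // mulrCA.
have a4 : D^-1 * (m * gg) <= gamma * gg.
  rewrite ler_pdivrMl // mulrA ler_wpM2r // (le_trans m2) // ler_peMl // ltW //.
have Q0 : 0 <= Q by rewrite -(pmulr_rge0 _ D0); have := mulr_ge0 m0 h0; lra.
have := mulr_ge0 (ltW g0) gg0; lra.
Qed.

(** * The resolvent of the walk and its dissipation inequality *)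

Section Lyapunov.
Variables (R : realType) (d n : nat) (gamma : R).
Hypotheses (d_gt0 : (0 < d)%N) (n_gt1 : (1 < n)%N) (gamma_gt0 : 0 < gamma).
Local Notation S := (state d n).
Local Notation fct := {ffun S -> R}.
Implicit Types (f g : fct).
Local Notation P := (@velocity_average R d n).
Local Notation adv := (@adv R d n).
Local Notation adv_adj := (@adv_adj R d n).
Local Notation mlap := (@mlap R d n).

Lemma sum_lap0 i f : \sum_s lap i f s = 0.
Proof.
under eq_bigr do rewrite !ffunE; rewrite sumrB -[X in _ - X]mulr_sumr.
rewrite big_split /=.
have e a : \sum_s f (tran a s) = \sum_s f s.
  by rewrite -[RHS](sum_tran a); apply: eq_bigr => s _; rewrite ffunE.
by rewrite !e; lra.
Qed.

Lemma sum_mlap f : \sum_s mlap f s = 0.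
Proof.
under eq_bigr do rewrite ffunE sum_ffunE.
by rewrite -mulr_sumr exchange_big big1 ?mulr0 // => i _; rewrite sum_lap0.
Qed.

Lemma sum_velocity_average f : \sum_s P f s = \sum_s f s.
Proof.
have e g : \sum_s g s = dot g [ffun => 1].
  by apply: eq_bigr => s _; rewrite ffunE mulr1.
rewrite !e dot_velocity_average //; congr dot.
by apply: velocity_average_fixed => // x v v'; rewrite !ffunE.
Qed.

(** The operator gamma^2 + d K is positive definite, hence injective. *)
Lemma resolvent_exists : exists W : {linear fct -> fct},
  forall f, gamma ^+ 2 *: W f + d%:R *: mlap (W f) = gamma *: f.
Proof.
pose A f := gamma ^+ 2 *: f + d%:R *: mlap f.
have Alin : linear A.
  move=> a f g; rewrite /A (linearP mlap) !scalerDr !scalerA.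
  by rewrite !(mulrC _ a) -!scalerA addrACA -scalerDr.
pose AM := GRing.isLinear.Build R fct fct _ A Alin.
pose A' : {linear fct -> fct} := HB.pack A AM.
have [f /= Af|G AG] := @injective_linear_inverse R {ffun S -> R} A'.
  apply: dot_eq0; apply/eqP; rewrite eq_le dot_ge0 andbT.
  have : dot (A f) f = 0 by rewrite Af dot0l.
  have := dot_mlap_ge0 f; rewrite /A !dotE => K0 e.
  have g2 : 0 < gamma ^+ 2 by rewrite exprn_gt0.
  rewrite -(pmulr_rle0 _ g2); have := mulr_ge0 (ler0n R d) K0; lra.
pose W f := G (gamma *: f).
have Wlin : linear W by move=> a f g; rewrite /W scalerDr scalerA mulrC -scalerA (linearP G).
pose WM := GRing.isLinear.Build R fct fct _ W Wlin.
by exists (HB.pack W WM : {linear fct -> fct}) => f; rewrite -(AG (gamma *: f)).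
Qed.

Variable W : {linear fct -> fct}.
Hypothesis W_eq : forall f, gamma ^+ 2 *: W f + d%:R *: mlap (W f) = gamma *: f.

Let gamma2_gt0 : 0 < gamma ^+ 2. Proof. by rewrite exprn_gt0. Qed.

(** Reduces each commutation property of [W] to applying an operator to the defining equation. *)
Lemma resolvent_unique f g :
  gamma ^+ 2 *: f + d%:R *: mlap f = gamma *: g -> W g = f.
Proof.
move=> fg; apply: subr0_eq; apply: dot_eq0; apply/eqP; rewrite eq_le dot_ge0 andbT.
have : gamma ^+ 2 *: (W g - f) + d%:R *: mlap (W g - f) = 0.
  rewrite (linearB mlap) /= !scalerBr addrACA -opprD fg W_eq subrr //.
move: (W g - f) => h h0; have := congr1 (fun k => dot k h) h0.
rewrite dot0l dotDl (dotZl (gamma ^+ 2)) (dotZl d%:R) => e.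
have := mulr_ge0 (ler0n R d) (dot_mlap_ge0 h) => K0.
by rewrite -(pmulr_rle0 _ gamma2_gt0); lra.
Qed.

Lemma resolvent_velocity_average f : W (P f) = P (W f).
Proof.
have PZ a h : P (a *: h) = a *: P h by exact: linearZ_LR.
apply: resolvent_unique; rewrite mlap_velocity_average.
by rewrite -[RHS]PZ -W_eq (linearD P) /= !PZ.
Qed.

Lemma resolvent_mlap f : W (mlap f) = mlap (W f).
Proof.
have mZ a h : mlap (a *: h) = a *: mlap h by exact: linearZ_LR.
by apply: resolvent_unique; rewrite -[RHS]mZ -W_eq (linearD mlap) /= !mZ.
Qed.

Lemma dot_resolvent f g : dot (W f) g = dot f (W g).
Proof.
apply: (mulfI (lt0r_neq0 gamma_gt0)).
rewrite -dotZr -dotZl -!W_eq dotDr dotDl (dotZr (gamma ^+ 2)) (dotZl (gamma ^+ 2)).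
by rewrite (dotZr d%:R) (dotZl d%:R) dot_mlap.
Qed.

(** Keeps W P f mean-zero, so that the Poincare inequality applies to it. *)
Lemma sum_resolvent f : \sum_s f s = 0 -> \sum_s W f s = 0.
Proof.
move=> f0; apply: (mulfI (lt0r_neq0 gamma2_gt0)); rewrite mulr0.
have := congr1 (fun k : fct => \sum_s k s) (W_eq f).
under eq_bigr do rewrite ffunE [X in X + _]ffunE [X in _ + X]ffunE.
under [RHS]eq_bigr do rewrite ffunE.
by rewrite big_split /= -!mulr_sumr sum_mlap f0 !mulr0 addr0.
Qed.

Let d_ge1 : 1 <= d%:R :> R. Proof. by rewrite ler1n. Qed.

Let kappa : R := (2 * n%:R ^+ 2)^-1.
Let kappa_gt0 : 0 < kappa.
Proof. by rewrite invr_gt0 mulr_gt0 // exprn_gt0 // ltr0n ltnW. Qed.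

Let C f := adv (W (P f)).

Lemma walk_cross_term_le f : - dot f f <= dot f (C f) <= dot f f.
Proof.
exact: (cross_term_le (@dotC _ _) (@dotDl _ _) (@dotZl _ _) (@dot_ge0 _ _) d_ge1 gamma_gt0
  (dot_velocity_average (n := n)) (velocity_average_idem d_gt0)
  (@dot_mlap_ge0 R d n) resolvent_velocity_average W_eq
  (dot_adv_velocity_average d_gt0)).
Qed.

Let norm_split f : dot f f = dot (P f) (P f) + dot (f - P f) (f - P f).
Proof.
have e : dot (P f) f = dot (P f) (P f).
  by rewrite -{1}(velocity_average_idem d_gt0) dot_velocity_average.
by move: (P f) e => h e; rewrite !dotE (dotC f h) e; lra.
Qed.

(** The bound is stated with 2 |f|^2 because this dominates the modified square norm. *)
Lemma walk_dissipation f : \sum_s f s = 0 ->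
  500^-1 * d%:R^-1 * Num.min (n%:R ^- 2 * gamma^-1) gamma * (2 * dot f f)
    <= - lyapunov C 68^-1 f (generator gamma f).
Proof.
move=> f0.
have d0 : 0 <= 68^-1 :> R by rewrite invr_ge0.
have d1 : 68 * 68^-1 <= 1 :> R by rewrite divff.
have := hypocoercive_dissipation (@dotC _ _) (@dotDl _ _) (@dotZl _ _) (@dot_ge0 _ _)
  d_ge1 gamma_gt0 (@dot_adv R d n) (@norm_adv_adj R d n) (@norm_adv R d n) (@dot_adv_self R d n)
  (dot_velocity_average (n := n)) (velocity_average_idem d_gt0)
  (@dot_mlap R d n) (@mlap_velocity_average R d n) (@dot_mlap_ge0 R d n)
  resolvent_velocity_average dot_resolvent resolvent_mlap W_eq
  (velocity_average_adv d_gt0) (dot_adv_velocity_average d_gt0) (norm_adv_adj_adv d_gt0)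
  f d0 d1.
rewrite /= -generatorE => H.
rewrite /lyapunov opprB addrC; apply: le_trans H.
have PW : P (W (P f)) = W (P f).
  by rewrite -resolvent_velocity_average velocity_average_idem.
have W0 : \sum_s W (P f) s = 0 by rewrite sum_resolvent // sum_velocity_average.
have Q := cross_dissipation_ge (@dotC _ _) (@dotDl _ _) (@dotZl _ _) (@dot_ge0 _ _) gamma_gt0
  (@dot_mlap R d n) W_eq (ltW kappa_gt0) (poincare d_gt0 n_gt1 PW W0).
rewrite norm_split.
have kE : n%:R ^- 2 = 2 * kappa by rewrite /kappa [(2 * _)^-1]invfM mulrA divff ?mul1r.
apply: (rate_arith gamma_gt0 kappa_gt0 d_ge1 _ _ _ (dot_ge0 _) (dot_ge0 _) Q).
- by rewrite le_min (ltW gamma_gt0) kE divr_ge0 ?mulr_ge0 // ltW.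
- by rewrite -ler_pdivlMr // -kE ge_min lexx.
- by rewrite ge_min lexx orbT.
Qed.

End Lyapunov.

Lemma lyapunov_exists (R : realType) (d n : nat) (gamma : R) :
  (0 < d)%N -> (1 < n)%N -> 0 < gamma ->
  exists (C : {ffun state d n -> R} -> {ffun state d n -> R}) (delta : R),
    [/\ linear C,
      forall f : {ffun state d n -> R}, dot f f / 2 <= lyapunov C delta f f <= 2 * dot f f &
      forall f : {ffun state d n -> R}, \sum_s f s = 0 ->
        500^-1 * d%:R^-1 * Num.min (n%:R ^- 2 * Num.max 1 gamma^-1) gamma
          * lyapunov C delta f f <= - lyapunov C delta f (generator gamma f)].
Proof.
move=> d_gt0 n_gt1 gamma_gt0.
have d_ge1 : 1 <= d%:R :> R by rewrite ler1n.
have n2 : 0 < n%:R ^+ 2 :> R by rewrite exprn_gt0 // ltr0n ltnW.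
have r0 : 0 <= 500^-1 * d%:R^-1 * Num.min (n%:R ^- 2 * Num.max 1 gamma^-1) gamma.
  apply: mulr_ge0; first by apply: mulr_ge0; rewrite invr_ge0 ler0n.
  rewrite le_min (ltW gamma_gt0) andbT.
  by rewrite mulr_ge0 ?invr_ge0 ?(ltW n2) // le_max ler01.
have [gamma_ge1|gamma_lt1] := leP 1 gamma.
  have gV : gamma^-1 <= 1 by rewrite invf_le1.
  (* With [delta] = 0 the form is the plain inner product, and any linear map can stand for the
     cross operator. *)
  exists (@mlap R d n), 0; split=> [a f g|f|f f0]; first exact: linearP.
    by rewrite /lyapunov mul0r subr0; have := dot_ge0 f; lra.
  rewrite /lyapunov !mul0r !subr0 max_l //.
  have n2_ge1 : 1 <= n%:R ^+ 2 :> R by rewrite exprn_ege1 // ler1n ltnW.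
  have k4 : (2 * n%:R ^+ 2)^-1 <= 4 * d%:R :> R.
    apply: (@le_trans _ _ 1); last by move: d_ge1; lra.
    rewrite invf_le1; last exact: mulr_gt0.
    by move: n2_ge1; lra.
  have Pf0 : \sum_s velocity_average f s = 0 by rewrite sum_velocity_average.
  have := coercive_dissipation (@dotC _ _) (@dotDl _ _) (@dotZl _ _) (@dot_ge0 _ _) d_ge1
    (@norm_adv R d n) (@dot_adv_self R d n) (dot_velocity_average (n := n))
    (velocity_average_idem d_gt0) (dot_adv_velocity_average d_gt0) gamma_ge1 k4
    (poincare d_gt0 n_gt1 (velocity_average_idem d_gt0 f) Pf0).
  rewrite /= -generatorE; apply: le_trans; rewrite ler_wpM2r ?dot_ge0 //.
  apply: (@le_trans _ _ (500^-1 * d%:R^-1 * n%:R ^- 2)).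
    by rewrite ler_wpM2l ?mulr_ge0 ?invr_ge0 ?ler0n // ge_min mulr1 lexx.
  rewrite !invfM mulrCA [leRHS]mulrA [2^-1 * _]mulrC.
  have p0 : 0 <= d%:R^-1 * n%:R ^- 2 :> R by rewrite mulr_ge0 ?invr_ge0 ?ler0n ?ltW.
  by move: p0; lra.
have [W W_eq] := resolvent_exists d n gamma_gt0.
exists (fun f => adv (W (velocity_average f))), 68^-1; split=> [a f g|f|f f0].
- by rewrite (linearP (@velocity_average R d n)) (linearP W) (linearP (@adv R d n)).
- have := walk_cross_term_le d_gt0 gamma_gt0 W_eq f; have := dot_ge0 f.
  by rewrite /lyapunov => h /andP[h1 h2]; apply/andP; split; lra.
- have gV : 1 <= gamma^-1 by rewrite invf_ge1 // ltW.
  apply: le_trans (walk_dissipation d_gt0 n_gt1 gamma_gt0 W_eq f0).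
  rewrite max_r // in r0 *; rewrite ler_wpM2l //.
  have := walk_cross_term_le d_gt0 gamma_gt0 W_eq f; have := dot_ge0 f.
  by rewrite /lyapunov => h /andP[h1 h2]; lra.
Qed.

(** * Exponentials of linear operators *)

Section Exponential.
Variables (R : realType) (S : finType) (A : {linear {ffun S -> R} -> {ffun S -> R}}).
Implicit Types (f g : {ffun S -> R}) (t : R).

Definition unit_fun (s : S) : {ffun S -> R} := [ffun x => (x == s)%:R].

Lemma ffun_decomposition f : f = \sum_s f s *: unit_fun s.
Proof.
apply/ffunP => x; rewrite sum_ffunE (bigD1 x) //= big1 => [|s sx].
  by rewrite !ffunE eqxx addr0 /GRing.scale /= mulr1.
by rewrite !ffunE eq_sym (negPf sx) /GRing.scale /= mulr0.
Qed.

Lemma linear_kernelE f s : A f s = \sum_x f x * A (unit_fun x) s.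
Proof.
rewrite {1}[f]ffun_decomposition linear_sum sum_ffunE; apply: eq_bigr => x _.
by rewrite linearZ ffunE.
Qed.

Definition exp_term f s t (k : nat) : R := t ^+ k / k`!%:R * iter k A f s.

Definition exp_coef f s (k : nat) : R := iter k A f s / k`!%:R.

Definition exp_op t f : {ffun S -> R} := [ffun s => limn (series (exp_term f s t))].

Lemma exp_term_coef f s t : series (exp_term f s t) = pseries (exp_coef f s) t.
Proof.
congr series; apply/funext => k.
by rewrite /exp_term /exp_coef [LHS]mulrAC [RHS]mulrC mulrA.
Qed.

Lemma exp_coef_diffs f s : pseries_diffs (exp_coef f s) = exp_coef (A f) s.
Proof.
apply/funext => k; rewrite /pseries_diffs /exp_coef factS natrM invfM -iterSr mulrCA.
by congr (_ * _); rewrite mulrA divff ?mul1r // pnatr_eq0.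
Qed.

Let M : R := \sum_x \sum_s `|A (unit_fun x) s|.

Let M_ge0 : 0 <= M.
Proof. by rewrite sumr_ge0 // => x _; rewrite sumr_ge0. Qed.

(** [M] is the sum of the absolute values of all matrix entries, so it bounds the l^1 operator norm.
    This compares the series with that of exp(M |t|). *)
Lemma norm_iter_le k f : \sum_s `|iter k A f s| <= M ^+ k * \sum_s `|f s|.
Proof.
elim: k f => [|k IH] f; first by rewrite expr0 mul1r.
rewrite iterSr; apply: le_trans (IH _) _; rewrite exprSr -mulrA ler_wpM2l ?exprn_ge0 //.
apply: (@le_trans _ _ (\sum_s \sum_x `|f x| * `|A (unit_fun x) s|)).
  apply: ler_sum => s _; rewrite linear_kernelE; apply: le_trans (ler_norm_sum _ _ _) _.
  by apply: ler_sum => x _; rewrite normrM.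
rewrite exchange_big /= mulr_sumr; apply: ler_sum => x _.
rewrite -mulr_sumr mulrC ler_wpM2r // /M [leRHS](bigD1 x) //= lerDl sumr_ge0 // => y _.
by rewrite sumr_ge0.
Qed.

Lemma is_cvg_exp_term f s t : cvgn (series (exp_term f s t)).
Proof.
apply: normed_cvg; set B := \sum_s `|f s|.
have B0 : 0 <= B by rewrite sumr_ge0.
apply: (@series_le_cvg _ _ (fun k => B * exp_coeff (M * `|t|) k)) => [k|k|k|].
- exact: normr_ge0.
- by rewrite mulr_ge0 // exp_coeff_ge0 // mulr_ge0.
- rewrite /exp_term /exp_coeff /= !normrM normrX normfV [`|k`!%:R|]ger0_norm // exprMn.
  rewrite mulrC mulrA mulrA ler_wpM2r ?invr_ge0 // mulrA ler_wpM2r ?exprn_ge0 // mulrC.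
  by apply: le_trans (norm_iter_le _ _); rewrite (bigD1 s) //= lerDl sumr_ge0.
- have -> : series (fun k => B * exp_coeff (M * `|t|) k) =
      (fun n => B * series (exp_coeff (M * `|t|)) n).
    by apply/funext => n; rewrite /series /= mulr_sumr.
  by apply: is_cvgMr; exact: is_cvg_series_exp_coeff.
Qed.

Lemma exp_op_lincomb (w : S -> R) f t :
  \sum_s w s * exp_op t f s = limn (series (fun k => \sum_s w s * exp_term f s t k)).
Proof.
apply/esym/cvg_lim => //.
have -> : series (fun k => \sum_s w s * exp_term f s t k) =
    (fun n => \sum_s w s * series (exp_term f s t) n).
  apply/funext => n; rewrite /series /= exchange_big; apply: eq_bigr => s _.
  by rewrite mulr_sumr.
apply: cvg_big => [|s _]; first exact: add_continuous.
by rewrite ffunE; apply: cvgMr; exact: is_cvg_exp_term.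
Qed.

Lemma exp_op_comm t f : exp_op t (A f) = A (exp_op t f).
Proof.
apply/ffunP => s; rewrite linear_kernelE; under [RHS]eq_bigr do rewrite mulrC.
rewrite exp_op_lincomb ffunE; congr (limn (series _)); apply/funext => k.
rewrite /exp_term -iterSr iterS linear_kernelE mulr_sumr; apply: eq_bigr => x _.
by rewrite mulrA [RHS]mulrC.
Qed.

Lemma exp_op_sum0 t f : (forall g, \sum_s A g s = 0) -> \sum_s f s = 0 ->
  \sum_s exp_op t f s = 0.
Proof.
move=> A0 f0; under eq_bigr do rewrite -[exp_op _ _ _]mul1r.
rewrite exp_op_lincomb; have -> : (fun k => \sum_s 1 * exp_term f s t k) = (fun=> 0).
  apply/funext => k; under eq_bigr do rewrite mul1r /exp_term.
  by rewrite -mulr_sumr; case: k => [|k]; rewrite ?f0 ?A0 mulr0.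
have -> : series (fun=> 0 : R) = (fun=> 0) by apply/funext => n; rewrite /series /= big1.
exact: lim_cst.
Qed.

Lemma exp_op0 f : exp_op 0 f = f.
Proof.
apply/ffunP => s; rewrite ffunE; apply/cvg_lim => //.
(* Shift by one: the empty partial sum is 0, and all later ones equal f s. *)
rewrite -(cvg_shiftS (series _)) /=.
have -> : (fun n => series (exp_term f s 0) n.+1) = (fun=> f s); last exact: cvg_cst.
apply/funext => n; rewrite /series /= big_nat_recl // big1 => [|k _].
  by rewrite /exp_term expr0 fact0 divff // mul1r addr0.
by rewrite /exp_term expr0n /= !mul0r.
Qed.

(** Each value is a power series in t. Termwise differentiation replaces f by A f, and A commutes
    with its exponential. *)
Lemma is_derive_exp_op f s t :
  is_derive t 1 (fun u => exp_op u f s) (A (exp_op t f) s).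
Proof.
have e g u : exp_op u g s = limn (pseries (exp_coef g s) u).
  by rewrite ffunE exp_term_coef.
rewrite -exp_op_comm e -exp_coef_diffs.
have -> : (fun u => exp_op u f s) = (fun u => limn (pseries (exp_coef f s) u)).
  by apply/funext => u; exact: e.
apply: (@pseries_snd_diffs _ _ (`|t| + 1)).
- by rewrite -exp_term_coef; exact: is_cvg_exp_term.
- by rewrite exp_coef_diffs -exp_term_coef; exact: is_cvg_exp_term.
- by rewrite !exp_coef_diffs -exp_term_coef; exact: is_cvg_exp_term.
- by rewrite [ltRHS]ger0_norm ?addr_ge0 // ltrDl.
Qed.

Lemma is_derive_bigsum (I : finType) (h : I -> R -> R) (dh : I -> R) t :
  (forall i, is_derive t 1 (h i) (dh i)) ->
  is_derive t 1 (fun u => \sum_i h i u) (\sum_i dh i).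
Proof.
move=> hd; have -> : (fun u => \sum_i h i u) = \sum_i h i.
  by apply/funext => u; rewrite fct_sumE.
elim/big_ind2 : _ => [|f df g dg fd gd|i _]; last exact: hd.
  exact: is_derive_cst.
exact: is_deriveD.
Qed.

End Exponential.

(** * Exponential decay from a dissipated quadratic form *)

Section Decay.
Variables (R : realType) (S : finType) (A : {linear {ffun S -> R} -> {ffun S -> R}}).
Variables (C : {ffun S -> R} -> {ffun S -> R}) (delta a : R).
Implicit Types (f g h : {ffun S -> R}) (k t : R).
Hypothesis C_linear : linear C.
Local Notation H := (lyapunov C delta).
Hypothesis H_equiv : forall f, dot f f / 2 <= H f f <= 2 * dot f f.
Hypothesis A_sum0 : forall f, \sum_s A f s = 0.
Hypothesis H_dissipation : forall f, \sum_s f s = 0 -> a * H f f <= - H f (A f).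

Lemma lyapunovC f g : H f g = H g f.
Proof. by rewrite /lyapunov dotC [dot f (C g) + _]addrC. Qed.

Lemma lyapunovDl f g h : H (f + g) h = H f h + H g h.
Proof.
have CD : C (f + g) = C f + C g by have := C_linear 1 f g; rewrite !scale1r.
rewrite /lyapunov CD !dotDl !dotDr; ring.
Qed.

Lemma lyapunovZl k f g : H (k *: f) g = k * H f g.
Proof.
have C0 : C 0 = 0 by have := C_linear (-1) 0 0; rewrite scaler0 addr0 scaleN1r addNr.
have CZ : C (k *: f) = k *: C f by have := C_linear k f 0; rewrite C0 !addr0.
rewrite /lyapunov CZ !dotZl !dotZr; ring.
Qed.

Lemma lyapunov_suml I (r : seq I) (F : I -> {ffun S -> R}) g :
  H (\sum_(i <- r) F i) g = \sum_(i <- r) H (F i) g.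
Proof.
have H0 : H 0 g = 0 by rewrite -(scale0r 0) lyapunovZl mul0r.
by elim/big_rec2: _ => [|i y z _ <-]; rewrite ?H0 // lyapunovDl.
Qed.

(** Writes the form as a polynomial in the coordinates, so that the scalar product rule
    differentiates it. *)
Lemma lyapunov_kernelE f g : H f g =
  \sum_x \sum_y f x * (g y * H (unit_fun R x) (unit_fun R y)).
Proof.
rewrite {1}[f]ffun_decomposition lyapunov_suml; apply: eq_bigr => x _.
rewrite lyapunovZl -mulr_sumr lyapunovC {1}[g]ffun_decomposition lyapunov_suml.
by congr (_ * _); apply: eq_bigr => y _; rewrite lyapunovZl lyapunovC.
Qed.

Lemma is_derive_lyapunov f t :
  is_derive t 1 (fun u => H (exp_op A u f) (exp_op A u f))
    (2 * H (exp_op A t f) (A (exp_op A t f))).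
Proof.
have -> : (fun u => H (exp_op A u f) (exp_op A u f)) = (fun u =>
    \sum_x \sum_y exp_op A u f x * (exp_op A u f y * H (unit_fun R x) (unit_fun R y))).
  by apply/funext => u; exact: lyapunov_kernelE.
set F := exp_op A t f.
have -> : 2 * H F (A F) = \sum_x \sum_y
    (F x * (A F y * H (unit_fun R x) (unit_fun R y))
     + (F y * H (unit_fun R x) (unit_fun R y)) * A F x).
  rewrite mulr_natl mulr2n {2}lyapunovC !lyapunov_kernelE -big_split /=.
  apply: eq_bigr => x _; rewrite -big_split /=; apply: eq_bigr => y _; ring.
apply: is_derive_bigsum => x; apply: is_derive_bigsum => y.
have dx := is_derive_exp_op A f x t; have dy := is_derive_exp_op A f y t.
set k := H _ _.
have -> : (fun u => exp_op A u f x * (exp_op A u f y * k)) =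
    (fun u => exp_op A u f x) * (k \*: (fun u => exp_op A u f y)).
  by apply/funext => u; rewrite /GRing.mul /= /GRing.scale /= [k * _]mulrC.
apply: is_derive_eq; rewrite -/F /GRing.scale /= -[k *: _]/(k * _); ring.
Qed.

(** Gronwall: exp(2 a u) H is nonincreasing in u. The equivalence constants 1/2 and 2 cost a factor
    4 in the square norm. *)
Lemma lyapunov_decay f t : \sum_s f s = 0 -> 0 <= t ->
  dot (exp_op A t f) (exp_op A t f) <= (2 * expR (- (a * t))) ^+ 2 * dot f f.
Proof.
move=> f0 t0.
pose y u := H (exp_op A u f) (exp_op A u f).
pose z u := expR (2 * a * u) * y u.
have dz (u : R) : is_derive u (1 : R) z
    (expR (2 * a * u) * (2 * H (exp_op A u f) (A (exp_op A u f)))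
      + y u * (2 * a * expR (2 * a * u))).
  have de : is_derive u (1 : R) (fun v : R => expR (2 * a * v)) (2 * a * expR (2 * a * u)).
    have -> : (fun v : R => expR (2 * a * v)) = expR \o (2 * a \*: id).
      by apply/funext => v.
    apply: is_derive_eq; rewrite /GRing.scale /=; ring.
  have dy := is_derive_lyapunov f u.
  have -> : z = (fun v => expR (2 * a * v)) * y by [].
  by apply: is_derive_eq; rewrite /GRing.scale /=.
have zle : z t <= z 0.
  apply: (@ler0_derive1_nincr R z 0 t) => //.
  - move=> u _; rewrite derive1E derive_val.
    have := H_dissipation (exp_op_sum0 u A_sum0 f0).
    have := expR_gt0 (2 * a * u); rewrite /y; set e := expR _; set h1 := H _ _; set h2 := H _ _.
    move=> e0 hh; have := ler_wpM2l (ltW e0) hh; lra.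
  - by apply: derivable_within_continuous => u _.
have z0E : z 0 = H f f by rewrite /z /y mulr0 expR0 mul1r exp_op0.
have /andP[h1 _] := H_equiv (exp_op A t f); have /andP[_ h2] := H_equiv f.
have zt : y t = expR (- (a * t)) ^+ 2 * z t.
  rewrite /z mulrA -expRM_natl -expRD; have -> : 2%:R * - (a * t) + 2 * a * t = 0 by ring.
  by rewrite expR0 mul1r.
rewrite z0E in zle.
have := ler_wpM2l (sqr_ge0 (expR (- (a * t)))) zle; rewrite -zt /y.
have := ler_wpM2l (sqr_ge0 (expR (- (a * t)))) h2; rewrite exprMn; lra.
Qed.

End Decay.

(** * Spectral gap and relaxation time *)

Section Generator.
Variables (K : numFieldType) (d n : nat) (gamma : K).
Implicit Types f g : {ffun state d n -> K}.

Lemma generator_is_linear : linear (@generator K d n gamma).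
Proof.
have vE a f g s : velocity_average (a *: f + g) s =
    a * velocity_average f s + velocity_average g s.
  rewrite !ffunE mulrCA -mulrDr; congr (_ * _).
  by rewrite mulr_sumr -big_split /=; apply: eq_bigr => w _; rewrite !ffunE.
move=> a f g; apply/ffunP => s; rewrite ffunE vE !ffunE /GRing.scale /=; ring.
Qed.
HB.instance Definition _ := GRing.isLinear.Build K {ffun state d n -> K}
  {ffun state d n -> K} _ (@generator K d n gamma) generator_is_linear.

(** Invariance of the uniform measure: the shift permutes the states, and averaging preserves the
    sum over each velocity fibre. *)
Lemma sum_generator f : (0 < d)%N -> \sum_s generator gamma f s = 0.
Proof.
move=> d_gt0; under eq_bigr do rewrite ffunE.
rewrite big_split /= sumrB -mulr_sumr sumrB.
have -> : \sum_s f (s.1 + dir_vec n s.2, s.2) = \sum_s f s.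
  by rewrite [RHS](reindex (@flow d n)) //=; exact: onW_bij (flow_bij _ _).
have -> : \sum_s velocity_average f s = \sum_s f s.
  rewrite (eq_bigr (fun p => velocity_average f (p.1, p.2))) => [|[]//].
  rewrite [RHS](eq_bigr (fun p => f (p.1, p.2))) => [|[]//].
  rewrite -(pair_bigA _ (fun x v => velocity_average f (x, v))).
  rewrite -(pair_bigA _ (fun x v => f (x, v))).
  apply: eq_bigr => x _ /=; under eq_bigr do rewrite ffunE /=.
  rewrite sumr_const card_dirE -[_ *+ _]mulr_natl mulrA divff ?mul1r //.
  by rewrite pnatr_eq0 muln_eq0 -lt0n d_gt0.
by rewrite !subrr mulr0 addr0.
Qed.

End Generator.

Lemma mean_eq0 (K : numFieldType) (d n : nat) (f : {ffun state d n -> K}) : (0 < d)%N ->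
  mean f = 0 <-> \sum_s f s = 0.
Proof.
move=> d_gt0; rewrite /mean; split=> [/eqP|->]; last by rewrite mulr0.
rewrite mulf_eq0 invr_eq0 pnatr_eq0 => /orP[/eqP c0|/eqP //].
have /card_gt0P[] : (0 < #|{: state d n}|)%N by apply/card_gt0P; exists (0, (Ordinal d_gt0, true)).
by move=> s; have := fintype0 s c0.
Qed.

(** Lets the spectrum on mean-zero functions be studied through eigenfunctions alone. *)
Lemma injective_set_bij (K : numFieldType) (d n : nat)
    (A : {linear {ffun state d n -> K} -> {ffun state d n -> K}}) : (0 < d)%N ->
  (forall f : {ffun state d n -> K}, \sum_s f s = 0 -> \sum_s A f s = 0) ->
  (forall f : {ffun state d n -> K}, \sum_s f s = 0 -> A f = 0 -> f = 0) ->
  set_bij (@mean_zero K (state d n)) (@mean_zero K (state d n)) A.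
Proof.
move=> d_gt0 A_sum A_inj.
(* [B] is [A] on the mean-zero functions and the identity on the constants. *)
pose B (f : {ffun state d n -> K}) : {ffun state d n -> K} :=
  A (f - [ffun => mean f]) + [ffun => mean f].
have meanP a (f g : {ffun state d n -> K}) : [ffun => mean (a *: f + g)] =
    a *: [ffun => mean f] + [ffun => mean g] :> {ffun state d n -> K}.
  apply/ffunP => s; rewrite !ffunE /mean /GRing.scale /= mulrCA -mulrDr; congr (_ * _).
  by rewrite mulr_sumr -big_split /=; apply: eq_bigr => x _; rewrite !ffunE.
have Blin : linear B.
  move=> a f g; rewrite /B meanP opprD addrACA -scalerBr (linearP A) scalerDr.
  by rewrite addrACA.
pose BM := GRing.isLinear.Build K {ffun state d n -> K} {ffun state d n -> K} _ B Blin.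
have S_gt0 : #|{: state d n}|%:R != 0 :> K.
  rewrite pnatr_eq0 -lt0n; apply/card_gt0P; exists (0, (Ordinal d_gt0, true)) => //.
have sum_mean (f : {ffun state d n -> K}) : \sum_(s : state d n) mean f = \sum_s f s.
  by rewrite sumr_const -[_ *+ _]mulr_natl /mean mulrA divff // mul1r.
have sub_mean (f : {ffun state d n -> K}) : \sum_s (f - [ffun => mean f]) s = 0.
  under eq_bigr do rewrite !ffunE; by rewrite sumrB sum_mean subrr.
have sumB (f : {ffun state d n -> K}) : \sum_s B f s = \sum_s f s.
  under eq_bigr do rewrite ffunE [X in _ + X]ffunE.
  by rewrite big_split /= A_sum // sum_mean add0r.
have mean0 (f : {ffun state d n -> K}) : \sum_s f s = 0 ->
    [ffun => mean f] = 0 :> {ffun state d n -> K}.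
  by move=> f0; apply/ffunP => s; rewrite !ffunE /mean f0 mulr0.
have [f /= Bf|G BG] := @injective_linear_inverse K {ffun state d n -> K} (HB.pack B BM).
  have f0 : \sum_s f s = 0.
    by rewrite -sumB; rewrite Bf big1 // => s _; rewrite ffunE.
  by apply: A_inj => //; move: Bf; rewrite /B mean0 // subr0 addr0.
split=> [f /(mean_eq0 _ d_gt0) f0|f g|f /(mean_eq0 _ d_gt0) f0] /=.
- by apply/(mean_eq0 _ d_gt0); exact: A_sum.
- rewrite !inE => /(mean_eq0 _ d_gt0) f0 /(mean_eq0 _ d_gt0) g0 AfAg.
  apply: subr0_eq; apply: A_inj; last by rewrite linearB /= AfAg subrr.
  by under eq_bigr do rewrite !ffunE; rewrite sumrB f0 g0 subrr.
- have Gf0 : \sum_s G f s = 0 by rewrite -sumB; have := BG f => /= ->.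
  exists (G f); first exact/(mean_eq0 _ d_gt0).
  by have := BG f; rewrite /= /B mean0 // subr0 addr0.
Qed.

(** * Real and imaginary parts of complex-valued functions *)

Section RealParts.
Variables (R : realType) (d n : nat) (gamma : R).
Implicit Types f : {ffun state d n -> R[i]}.

Definition re_fun f : {ffun state d n -> R} := [ffun s => complex.Re (f s)].
Definition im_fun f : {ffun state d n -> R} := [ffun s => complex.Im (f s)].

Lemma Re_realM (r : R) (z : R[i]) : complex.Re (r%:C%C * z) = r * complex.Re z.
Proof. by case: z => a b /=; rewrite mul0r subr0. Qed.

Lemma Im_realM (r : R) (z : R[i]) : complex.Im (r%:C%C * z) = r * complex.Im z.
Proof. by case: z => a b /=; rewrite mul0r addr0. Qed.

Let realV : (2 * d)%:R^-1 = ((2 * d)%:R^-1)%:C%C :> R[i].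
Proof. by rewrite fmorphV rmorph_nat. Qed.

Lemma re_generator f : re_fun (generator gamma%:C%C f) = generator gamma (re_fun f).
Proof.
have ReD (z w : R[i]) : complex.Re (z + w) = complex.Re z + complex.Re w by case: z w => ? ? [].
have ReN (z : R[i]) : complex.Re (- z) = - complex.Re z by case: z.
apply/ffunP => s; rewrite !ffunE realV !(ReD, ReN, Re_realM) (raddf_sum (@complex.Re R)).
by congr (_ + _ * (_ * _ - _)); apply: eq_bigr => w _; rewrite ffunE.
Qed.

Lemma im_generator f : im_fun (generator gamma%:C%C f) = generator gamma (im_fun f).
Proof.
have ImD (z w : R[i]) : complex.Im (z + w) = complex.Im z + complex.Im w by case: z w => ? ? [].
have ImN (z : R[i]) : complex.Im (- z) = - complex.Im z by case: z.
apply/ffunP => s; rewrite !ffunE realV !(ImD, ImN, Im_realM) (raddf_sum (@complex.Im R)).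
by congr (_ + _ * (_ * _ - _)); apply: eq_bigr => w _; rewrite ffunE.
Qed.

Lemma sum_re f : \sum_s f s = 0 -> \sum_s re_fun f s = 0.
Proof.
by move=> f0; under eq_bigr do rewrite ffunE; rewrite -raddf_sum /= f0.
Qed.

Lemma sum_im f : \sum_s f s = 0 -> \sum_s im_fun f s = 0.
Proof.
by move=> f0; under eq_bigr do rewrite ffunE; rewrite -raddf_sum /= f0.
Qed.

End RealParts.

(** * From the dissipation inequality to the gap and the operator norm *)

Section Bounds.
Variables (R : realType) (d n : nat) (gamma : R).
Hypothesis d_gt0 : (0 < d)%N.
Variables (C : {ffun state d n -> R} -> {ffun state d n -> R}) (delta a : R).
Implicit Types f : {ffun state d n -> R}.
Hypothesis C_linear : linear C.
Local Notation H := (lyapunov C delta).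
Hypothesis H_equiv : forall f, dot f f / 2 <= H f f <= 2 * dot f f.
Hypothesis H_dissipation : forall f, \sum_s f s = 0 ->
  a * H f f <= - H f (generator gamma f).

(** Write f = u + i v and add the dissipation inequalities for u and v. The terms with Im lambda
    cancel by symmetry of H, leaving a (H(u,u) + H(v,v)) <= Re lambda (H(u,u) + H(v,v)). *)
Lemma eigenvalue_ge (lambda : R[i]) (f : {ffun state d n -> R[i]}) :
  f <> 0 -> \sum_s f s = 0 ->
  (forall s, - generator gamma%:C%C f s = lambda * f s) -> a <= complex.Re lambda.
Proof.
move=> f_neq0 f0 eig.
set u := re_fun f; set v := im_fun f; set al := complex.Re lambda; set be := complex.Im lambda.
have ReM (x y : R[i]) : complex.Re (x * y) =
    complex.Re x * complex.Re y - complex.Im x * complex.Im y by case: x y => ? ? [].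
have ImM (x y : R[i]) : complex.Im (x * y) =
    complex.Re x * complex.Im y + complex.Im x * complex.Re y by case: x y => ? ? [].
have ReN (x : R[i]) : complex.Re (- x) = - complex.Re x by case: x.
have ImN (x : R[i]) : complex.Im (- x) = - complex.Im x by case: x.
have scE k (g : {ffun state d n -> R}) s : (k *: g) s = k * g s by rewrite ffunE.
have uE s : u s = complex.Re (f s) by rewrite ffunE.
have vE s : v s = complex.Im (f s) by rewrite ffunE.
have Lu : generator gamma u = (- al) *: u + be *: v.
  rewrite -re_generator; apply/ffunP => s; rewrite [LHS]ffunE [RHS]ffunE !scE uE vE.
  have := congr1 (@complex.Re R) (eig s); rewrite ReN ReM -/al -/be; lra.
have Lv : generator gamma v = (- al) *: v + (- be) *: u.
  rewrite -im_generator; apply/ffunP => s; rewrite [LHS]ffunE [RHS]ffunE !scE uE vE.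
  have := congr1 (@complex.Im R) (eig s); rewrite ImN ImM -/al -/be; lra.
have HDr := lyapunovDl delta C_linear; have HZ := lyapunovZl delta C_linear.
have HC := lyapunovC C delta.
have := H_dissipation (sum_re f0); have := H_dissipation (sum_im f0).
rewrite -/u -/v Lu Lv ![H _ (_ + _)]HC !HDr !HZ (HC u v) => Dv Du.
have /andP[Hu _] := H_equiv u; have /andP[Hv _] := H_equiv v.
have uv : 0 < dot u u + dot v v.
  rewrite lt0r addr_ge0 ?dot_ge0 // andbT paddr_eq0 ?dot_ge0 //.
  apply/negP => /andP[/eqP/dot_eq0 u0 /eqP/dot_eq0 v0]; apply: f_neq0; apply/ffunP => s.
  have := congr1 (fun h : {ffun _ -> R} => h s) u0.
  have := congr1 (fun h : {ffun _ -> R} => h s) v0.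
  by rewrite !ffunE; case: (f s) => x y /= -> ->.
have Huv : 0 < H u u + H v v by move: Hu Hv uv; lra.
by rewrite -(ler_pM2r Huv); move: Dv Du; lra.
Qed.

(** If Re lambda < a, then -L - lambda has no mean-zero kernel, so it is bijective and lambda lies
    outside the spectrum. *)
Lemma gap_ge : (a%:E <= gap d n gamma)%E.
Proof.
apply: le_ereal_inf_tmp => _ [lambda spec <-]; rewrite lee_fin; apply: contrapT => lt_a.
apply: spec.
pose A (f : {ffun state d n -> R[i]}) : {ffun state d n -> R[i]} :=
  - generator gamma%:C%C f - [ffun s => lambda * f s].
have Alin : linear A.
  move=> k f g; rewrite /A (linearP (@generator _ d n gamma%:C%C)) /=.
  apply/ffunP => s; rewrite !ffunE /GRing.scale /=; ring.
pose AM := GRing.isLinear.Build _ {ffun state d n -> R[i]} {ffun state d n -> R[i]} _ A Alin.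
apply: (@injective_set_bij _ d n (HB.pack A AM)) => //= [f f0|f f0 Af].
  rewrite /A; under eq_bigr do rewrite ffunE [X in X + _]ffunE [X in _ + X]ffunE [X in _ - X]ffunE.
  by rewrite sumrB -mulr_sumr f0 mulr0 subr0 sumrN sum_generator // oppr0.
apply: contrapT => f_neq0; apply: lt_a; apply: eigenvalue_ge f_neq0 f0 _ => s.
have := congr1 (fun h : {ffun state d n -> R[i]} => h s) Af.
rewrite ffunE [X in X + _]ffunE [X in _ + X]ffunE [X in _ - X]ffunE [RHS]ffunE.
by move/eqP; rewrite subr_eq0 => /eqP.
Qed.

Lemma L2normE f : L2norm f = Num.sqrt (#|{: state d n}|%:R^-1 * dot f f).
Proof.
congr (Num.sqrt (_ * _)); apply: eq_bigr => s _.
by rewrite ffunE real_normK ?num_real.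
Qed.

Lemma opnorm_semigroup_le (eps t : R) : 0 <= t -> 2 * expR (- (a * t)) <= eps ->
  (mean_zero_opnorm (@semigroup R d n gamma t) <= eps%:E)%E.
Proof.
move=> t0 le_eps; apply: ge_ereal_sup => _ [f [/(mean_eq0 _ d_gt0) f0 /= f1] <-].
have A0 (g : {ffun state d n -> R}) : \sum_s generator gamma g s = 0 := sum_generator gamma g d_gt0.
have := lyapunov_decay C_linear H_equiv A0 H_dissipation f0 t0.
(* The semigroup is by definition [exp_op] of the generator. *)
rewrite -[exp_op _ t f]/(semigroup gamma t f).
set k := 2 * _; move=> decay; rewrite lee_fin.
have k0 : 0 <= k by rewrite mulr_ge0 // expR_ge0.
apply: le_trans le_eps; apply: (@le_trans _ _ (k * L2norm f)); last by rewrite ler_piMr.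
have kE : k = Num.sqrt (k ^+ 2) by rewrite sqrtr_sqr ger0_norm.
rewrite !L2normE kE -sqrtrM ?sqr_ge0 // ler_wsqrtr // mulrCA.
by rewrite ler_wpM2l // invr_ge0.
Qed.

End Bounds.

(** The time bound assumes [eps <= n%:R]: for larger [eps] the logarithm makes its right side
    negative, whereas a relaxation time is nonnegative. *)
Theorem theorem22 (R : realType) :
  exists c C : R, 0 < c /\ 0 < C /\
  forall (d n : nat) (gamma eps : R),
    (0 < d)%N -> (2 <= n)%N -> 0 < gamma -> 0 < eps ->
    ((c * d%:R^-1
        * Num.min (n%:R ^- 2 * Num.max 1 gamma^-1) gamma)%:E
       <= gap d n gamma)%E
    /\
    (eps <= n%:R ->
     (t_rel d n gamma eps
       <= (C * d%:R ^+ 2 * Num.max (n%:R ^+ 2 * Num.min 1 gamma) gamma^-1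
             * ln (n%:R / eps))%:E)%E).
Proof.
exists 500^-1, 500; split; first by rewrite invr_gt0 ltr0n.
split; first by rewrite ltr0n.
move=> d n gamma eps d_gt0 n_gt1 gamma_gt0 eps_gt0.
have [C [delta [C_linear H_equiv H_dissipation]]] := lyapunov_exists d_gt0 n_gt1 gamma_gt0.
split; first exact: (gap_ge d_gt0 C_linear H_equiv H_dissipation).
move=> eps_le_n.
have n_gt0 : 0 < n%:R :> R by rewrite ltr0n ltnW.
set m := Num.min _ _ in H_dissipation; set M := Num.max _ _.
(* The first entries of the minimum and the maximum are reciprocal, and so are the second ones. *)
have mM : 1 <= m * M.
  have XE : n%:R ^- 2 * Num.max 1 gamma^-1 * (n%:R ^+ 2 * Num.min 1 gamma) = 1.
    have n2_neq0 : n%:R ^+ 2 != 0 :> R by rewrite expf_neq0 // gt_eqF.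
    rewrite mulrACA mulVf // mul1r; have [g1|g1] := leP 1 gamma.
      by rewrite max_l ?mulr1 // invf_le1.
    by rewrite max_r ?mulVf ?gt_eqF // invf_ge1 // ltW.
  have X_ge0 : 0 <= n%:R ^- 2 * Num.max 1 gamma^-1.
    by rewrite mulr_ge0 ?invr_ge0 ?exprn_ge0 ?(ltW n_gt0) // le_max ler01.
  rewrite /m; have [_|_] := leP (n%:R ^- 2 * _) gamma.
    have le_M : n%:R ^+ 2 * Num.min 1 gamma <= M by rewrite /M le_max lexx.
    by have := ler_wpM2l X_ge0 le_M; rewrite XE.
  by rewrite mulrC -ler_pdivrMr // div1r /M le_max lexx orbT.
have ln_ge0 : 0 <= ln (n%:R / eps) by rewrite ln_ge0 // ler_pdivlMr // mul1r.
have M_ge0 : 0 <= M by rewrite /M le_max invr_ge0 (ltW gamma_gt0) orbT.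
have d_ge1 : 1 <= d%:R :> R by rewrite ler1n.
set t := _ * _ * _ * _.
have t_ge0 : 0 <= t.
  apply: mulr_ge0 ln_ge0; apply: mulr_ge0 M_ge0.
  by apply: mulr_ge0; [exact: ler0n | exact: sqr_ge0].
apply: ge_ereal_inf; exists t%:E => //; exists t => //; split=> //.
apply: (opnorm_semigroup_le d_gt0 C_linear H_equiv H_dissipation t_ge0).
(* One factor d of [t] cancels the d^-1 of the rate, and the other is at least 1. *)
have at_ge : ln (n%:R / eps) <= 500^-1 * d%:R^-1 * m * t.
  have -> : 500^-1 * d%:R^-1 * m * t = d%:R * (m * M) * ln (n%:R / eps).
    by rewrite /t; field; rewrite pnatr_eq0 -lt0n d_gt0.
  by rewrite ler_peMl // mulr_ege1.
(* The prefactor 2 from the norm equivalence is absorbed by n >= 2, since 2 exp(- ln (n / eps)) = 2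
   eps / n <= eps. *)
apply: (@le_trans _ _ (2 * expR (- ln (n%:R / eps)))).
  by rewrite ler_wpM2l // ler_expR lerN2.
rewrite expRN lnK ?posrE ?divr_gt0 // invf_div mulrA ler_pdivrMr // mulrC.
by rewrite ler_wpM2l ?(ltW eps_gt0) // ler_nat.
Qed.
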